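(* Let $A$ be a unital separable $C^*$-algebra which is a quotient generator (every separable $C^*$-algebra is $*$-isomorphic to $A/K$ for some closed two-sided ideal $K$ of $A$). Equip $\mathrm{Ideal}(A)$ with the Wijsman topology. Then there is a Borel map \[ \kappa_{K_0}:\mathrm{Ideal}(A)\to\mathrm{Sub}(\mathbb{Z}^{(\mathbb{N})}) \] such that $\mathbb{Z}^{(\mathbb{N})}/\kappa_{K_0}(K)\cong K_0(A/K)$ for every $K\in\mathrm{Ideal}(A)$. Moreover, for each fixed $z\in\mathbb{Z}^{(\mathbb{N})}$, the set $\{K\in\mathrm{Ideal}(A): z\in \kappa_{K_0}(K)\}$ is $F_\sigma$ in the Wijsman topology.
   Context: $\mathrm{Ideal}(A)$ denotes the set of closed two-sided ideals of $A$, regarded as closed subsets of $A$. The Wijsman topology on $\mathrm{Ideal}(A)$ is the coarsest topology making each map $K\mapsto d(x,K)=\inf_{y\in K}\|x-y\|$ continuous, for every fixed $x\in A$. $\mathbb{Z}^{(\mathbb{N})}=\bigoplus_{n\in\mathbb{N}}\mathbb{Z}e_n$, and $\mathrm{Sub}(\mathbb{Z}^{(\mathbb{N})})$ is the set of subgroups of $\mathbb{Z}^{(\mathbb{N})}$, viewed as a closed subset of the Cantor space $2^{\mathbb{Z}^{(\mathbb{N})}}$ with the product topology. *)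

(* Defs.v *)
From HB Require Import structures.
From mathcomp Require Import all_boot all_order all_algebra.
From mathcomp Require Import all_classical all_reals all_analysis.
From mathcomp Require Import borel_hierarchy generic_quotient ring_quotient.
From mathcomp Require Import complex freeg ssrAC.
From mathcomp Require Import lra.

Set Implicit Arguments.
Unset Strict Implicit.
Unset Printing Implicit Defensive.

Import Order.TTheory GRing.Theory Num.Theory.
Import numFieldNormedType.Exports.

Local Open Scope classical_set_scope.
Local Open Scope ring_scope.
Local Open Scope complex_scope.
Local Open Scope quotient_scope.

(* The algebras are packed by hand rather than as joins of library structures,
   because [algType] excludes the zero algebra, which must be allowed here:
   it is the quotient of an algebra by itself. *)
Record star_algebra_on (C : numClosedFieldType) (V : lmodType C) :=
  StarAlgebraOn {
  alg_one : V;
  alg_mul : V -> V -> V;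
  alg_star : V -> V;
  alg_mulA : associative alg_mul;
  alg_mul1r : left_id alg_one alg_mul;
  alg_mulr1 : right_id alg_one alg_mul;
  alg_mulDl : left_distributive alg_mul +%R;
  alg_mulDr : right_distributive alg_mul +%R;
  alg_scaleAl : forall (c : C) x y, c *: alg_mul x y = alg_mul (c *: x) y;
  alg_scaleAr : forall (c : C) x y, c *: alg_mul x y = alg_mul x (c *: y);
  alg_starK : involutive alg_star;
  alg_starD : {morph alg_star : x y / x + y};
  alg_starM : forall x y, alg_star (alg_mul x y) =
                          alg_mul (alg_star y) (alg_star x);
  alg_starZ : forall (c : C) x, alg_star (c *: x) = Num.conj c *: alg_star x }.

Record starAlg (C : numClosedFieldType) := StarAlg {
  star_base : lmodType C;
  star_class : star_algebra_on star_base }.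

Definition star_sort (C : numClosedFieldType) (S : starAlg C) : Type :=
  star_base S.
Coercion star_sort : starAlg >-> Sortclass.

Section StarAlgInstances.
Variables (C : numClosedFieldType) (S : starAlg C).
HB.instance Definition _ := GRing.Lmodule.copy (star_sort S) (star_base S).
HB.instance Definition _ := GRing.Zmodule_isPzRing.Build (star_sort S)
  (alg_mulA (star_class S)) (alg_mul1r (star_class S))
  (alg_mulr1 (star_class S)) (alg_mulDl (star_class S))
  (alg_mulDr (star_class S)).
Definition star (x : S) : S := alg_star (star_class S) x.
End StarAlgInstances.

Record cstarAlg (R : realType) := CstarAlg {
  cstar_base : completeNormedModType R[i];
  cstar_class : star_algebra_on cstar_base;
  cstar_normM_subproof : forall x y : cstar_base,
    `|alg_mul cstar_class x y| <= `|x| * `|y|;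
  cstar_identity_subproof : forall x : cstar_base,
    `|alg_mul cstar_class (alg_star cstar_class x) x| = `|x| ^+ 2 }.

Definition cstar_sort (R : realType) (A : cstarAlg R) : Type := cstar_base A.
Coercion cstar_sort : cstarAlg >-> Sortclass.

Section CstarAlgInstances.
Variables (R : realType) (A : cstarAlg R).
HB.instance Definition _ :=
  CompleteNormedModule.copy (cstar_sort A) (cstar_base A).
HB.instance Definition _ := GRing.Zmodule_isPzRing.Build (cstar_sort A)
  (alg_mulA (cstar_class A)) (alg_mul1r (cstar_class A))
  (alg_mulr1 (cstar_class A)) (alg_mulDl (cstar_class A))
  (alg_mulDr (cstar_class A)).
End CstarAlgInstances.

Definition starAlg_of (R : realType) (A : cstarAlg R) : starAlg R[i] :=
  StarAlg (cstar_class A).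
Coercion starAlg_of : cstarAlg >-> starAlg.

Definition cstar (R : realType) (A : cstarAlg R) (x : A) : A :=
  alg_star (cstar_class A) x.


Section StarTheory.
Variables (C : numClosedFieldType) (S : starAlg C).
Implicit Types x y : S.

Lemma starK : involutive (@star C S).
Proof. exact: (alg_starK (star_class S)). Qed.

Lemma starD : {morph @star C S : x y / x + y}.
Proof. exact: (alg_starD (star_class S)). Qed.

Lemma starM x y : star (x * y) = star y * star x.
Proof. exact: (alg_starM (star_class S)). Qed.

Lemma starZ (c : C) x : star (c *: x) = Num.conj c *: star x.
Proof. exact: (alg_starZ (star_class S)). Qed.

Lemma star0 : star (0 : S) = 0.
Proof. by apply: (addrI (star 0)); rewrite -starD !addr0. Qed.

Definition mxstar m n (M : 'M[S]_(m, n)) : 'M[S]_(n, m) :=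
  (map_mx (@star C S) M)^T.

Lemma mxstarK m n (M : 'M[S]_(m, n)) : mxstar (mxstar M) = M.
Proof. by apply/matrixP=> i j; rewrite !mxE starK. Qed.

Lemma mxstar0 m n : mxstar (0 : 'M[S]_(m, n)) = 0.
Proof. by apply/matrixP=> i j; rewrite !mxE star0. Qed.

Lemma mxstarM m n p (M : 'M[S]_(m, n)) (N : 'M[S]_(n, p)) :
  mxstar (M *m N) = mxstar N *m mxstar M.
Proof.
apply/matrixP=> i j; rewrite !mxE (big_morph _ starD star0).
by apply: eq_bigr => k _; rewrite starM !mxE.
Qed.

Lemma mxstar_block m1 m2 n1 n2 (a : 'M[S]_(m1, n1)) (b : 'M[S]_(m1, n2))
    (c : 'M[S]_(m2, n1)) (d : 'M[S]_(m2, n2)) :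
  mxstar (block_mx a b c d) =
  block_mx (mxstar a) (mxstar c) (mxstar b) (mxstar d).
Proof. by rewrite /mxstar map_block_mx tr_block_mx. Qed.

Record projection := Projection {
  proj_dim : nat;
  proj_mx :> 'M[S]_proj_dim;
  proj_idem : proj_mx *m proj_mx = proj_mx;
  proj_selfadj : mxstar proj_mx = proj_mx }.

HB.instance Definition _ := gen_eqMixin projection.
HB.instance Definition _ := gen_choiceMixin projection.

(* Murray-von Neumann equivalence of projections of possibly different sizes *)
Definition mvn (p q : projection) : Prop :=
  exists v : 'M[S]_(proj_dim q, proj_dim p),
    mxstar v *m v = p /\ v *m mxstar v = q.

Lemma mvn_refl p : mvn p p.
Proof. by exists p; rewrite proj_selfadj proj_idem. Qed.

Lemma mvn_sym p q : mvn p q -> mvn q p.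
Proof. by case=> v [vp vq]; exists (mxstar v); rewrite mxstarK. Qed.

Lemma mvn_trans q p r : mvn p q -> mvn q r -> mvn p r.
Proof.
move=> [v [vp vq]] [w [wq wr]]; exists (w *m v); rewrite mxstarM; split.
  by rewrite mulmxA -(mulmxA _ _ w) wq -vq !mulmxA vp -mulmxA vp proj_idem.
by rewrite mulmxA -(mulmxA w) vq -wq !mulmxA wr -mulmxA wr proj_idem.
Qed.

Definition mvnb (p q : projection) : bool := `[< mvn p q >].

Lemma mvnb_is_equiv : equiv_class_of mvnb.
Proof.
split=> [p|p q|q p r]; first by apply/asboolP/mvn_refl.
  by apply/asboolP/asboolP => /mvn_sym.
by move=> /asboolP pq /asboolP qr; apply/asboolP/(mvn_trans pq qr).
Qed.

Canonical mvnb_equiv := EquivRelPack mvnb_is_equiv.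
Canonical mvnb_encModRel := defaultEncModRel mvnb.

(* The monoid of Murray-von Neumann classes of projections in matrices over S *)
Definition Vmonoid := {eq_quot mvnb}.
HB.instance Definition _ := EqQuotient.on Vmonoid.
HB.instance Definition _ := Choice.on Vmonoid.

Lemma mvn_pi p q : mvn p q <-> \pi_Vmonoid p = \pi_Vmonoid q.
Proof. by split=> [pq|/eqmodP/asboolP//]; apply/eqmodP/asboolP. Qed.

Definition proj0 : projection :=
  @Projection 0 0 (mulmx0 0 0) (mxstar0 0 0).

Lemma proj_sum_idem (p q : projection) :
  block_mx p 0 0 q *m block_mx p 0 0 q = block_mx p 0 0 q.
Proof. by rewrite mulmx_block !mulmx0 !mul0mx !addr0 !add0r !proj_idem. Qed.

Lemma proj_sum_selfadj (p q : projection) :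
  mxstar (block_mx p 0 0 q) = block_mx p 0 0 q.
Proof. by rewrite mxstar_block !mxstar0 !proj_selfadj. Qed.

Definition proj_sum (p q : projection) : projection :=
  Projection (proj_sum_idem p q) (proj_sum_selfadj p q).

Lemma mvn_sum p p' q q' :
  mvn p p' -> mvn q q' -> mvn (proj_sum p q) (proj_sum p' q').
Proof.
move=> [v [vp vp']] [w [wq wq']]; exists (block_mx v 0 0 w).
rewrite mxstar_block !mxstar0 !mulmx_block !mulmx0 !mul0mx !addr0 !add0r.
by rewrite vp vp' wq wq'.
Qed.

Lemma mvn_sumC p q : mvn (proj_sum p q) (proj_sum q p).
Proof.
exists (block_mx 0 q p 0).
rewrite mxstar_block !mxstar0 !mulmx_block !mulmx0 !mul0mx !addr0 !add0r.
by rewrite !proj_selfadj !proj_idem.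
Qed.

Lemma mvn_cast p q (e : proj_dim p = proj_dim q) :
  castmx (e, e) (p : 'M[S]_(proj_dim p)) = q -> mvn p q.
Proof.
case: p q e => [n P iP sP] [m Q iQ sQ] /= e; case: m / e Q iQ sQ => Q iQ sQ.
by rewrite castmx_id => QE; exists P; rewrite /= sP iP -QE.
Qed.

Lemma mvn_sumA p q r :
  mvn (proj_sum p (proj_sum q r)) (proj_sum (proj_sum p q) r).
Proof.
apply/mvn_sym; apply: (@mvn_cast (proj_sum (proj_sum p q) r)
  (proj_sum p (proj_sum q r)) (esym (addnA _ _ _))) => /=.
have := @block_mxA _ _ _ _ _ _ _ (p : 'M[S]_(proj_dim p)) 0 0
  0 (q : 'M[S]_(proj_dim q)) 0 0 0 (r : 'M[S]_(proj_dim r)).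
by rewrite /= !row_mx0 !col_mx0 => ->.
Qed.

Lemma mvn_sum0 p : mvn (proj_sum proj0 p) p.
Proof.
exists (row_mx 0 p); rewrite /mxstar map_row_mx tr_row_mx -!/(mxstar _).
rewrite mxstar0 proj_selfadj mul_col_row mul_row_col !mulmx0 !mul0mx add0r.
by rewrite proj_idem; split=> //; congr block_mx.
Qed.

Definition Vadd (a b : Vmonoid) : Vmonoid :=
  \pi_Vmonoid (proj_sum (repr a) (repr b)).

Lemma Vadd_pi p q :
  Vadd (\pi_Vmonoid p) (\pi_Vmonoid q) = \pi_Vmonoid (proj_sum p q).
Proof. by apply/mvn_pi/mvn_sum; apply/mvn_pi; rewrite reprK. Qed.

Lemma VaddA : associative Vadd.
Proof.
elim/quotW=> p; elim/quotW=> q; elim/quotW=> r.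
rewrite (Vadd_pi q) (Vadd_pi p q) !Vadd_pi.
by apply/mvn_pi; apply: mvn_sumA.
Qed.

Lemma VaddC : commutative Vadd.
Proof.
by elim/quotW=> p; elim/quotW=> q; rewrite Vadd_pi (Vadd_pi q); apply/mvn_pi; apply: mvn_sumC.
Qed.

Lemma Vadd0 : left_id (\pi_Vmonoid proj0) Vadd.
Proof. by elim/quotW=> p; rewrite Vadd_pi; apply/mvn_pi; apply: mvn_sum0. Qed.

HB.instance Definition _ := GRing.isNmodule.Build Vmonoid VaddA VaddC Vadd0.

End StarTheory.

Section Grothendieck.
Variable M : nmodType.
Implicit Types x y z : M * M.

Definition groth_rel x y : bool :=
  `[< exists t, x.1 + y.2 + t = y.1 + x.2 + t >].

Lemma groth_rel_is_equiv : equiv_class_of groth_rel.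
Proof.
split=> [x|x y|y x z]; first by apply/asboolP; exists 0.
  by apply/asboolP/asboolP => -[t e]; exists t.
move=> /asboolP[t xy] /asboolP[u yz]; apply/asboolP.
exists (y.1 + y.2 + t + u).
transitivity ((x.1 + y.2 + t) + (y.1 + z.2 + u)); last rewrite xy yz.
  by rewrite !addrA [LHS](ACl (1*4*5*3*2*6)).
by rewrite !addrA [LHS](ACl (4*2*1*5*3*6)).
Qed.

Canonical groth_rel_equiv := EquivRelPack groth_rel_is_equiv.
Canonical groth_rel_encModRel := defaultEncModRel groth_rel.

(* The class of (x, y) stands for the formal difference x - y. *)
Definition grothendieck := {eq_quot groth_rel}.
HB.instance Definition _ := EqQuotient.on grothendieck.
HB.instance Definition _ := Choice.on grothendieck.

Lemma groth_pi x y : (exists t, x.1 + y.2 + t = y.1 + x.2 + t) <->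
  \pi_grothendieck x = \pi_grothendieck y.
Proof. by split=> [xy|/eqmodP/asboolP//]; apply/eqmodP/asboolP. Qed.

Definition groth_add (a b : grothendieck) : grothendieck :=
  \pi_grothendieck ((repr a).1 + (repr b).1, (repr a).2 + (repr b).2).

Definition groth_opp (a : grothendieck) : grothendieck :=
  \pi_grothendieck ((repr a).2, (repr a).1).

Lemma groth_add_pi x y :
  groth_add (\pi_grothendieck x) (\pi_grothendieck y) =
  \pi_grothendieck (x.1 + y.1, x.2 + y.2).
Proof.
rewrite /groth_add; set x' := repr _; set y' := repr _.
have /groth_pi[t xt] : \pi_grothendieck x' = \pi_grothendieck x by rewrite reprK.
have /groth_pi[u yu] : \pi_grothendieck y' = \pi_grothendieck y by rewrite reprK.
apply/groth_pi; exists (t + u) => /=.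
transitivity ((x'.1 + x.2 + t) + (y'.1 + y.2 + u)); last rewrite xt yu.
  by rewrite !addrA [LHS](ACl (1*3*5*2*4*6)).
by rewrite !addrA [LHS](ACl (1*4*2*5*3*6)).
Qed.

Lemma groth_opp_pi x :
  groth_opp (\pi_grothendieck x) = \pi_grothendieck (x.2, x.1).
Proof.
rewrite /groth_opp; set x' := repr _.
have /groth_pi[t xt] : \pi_grothendieck x' = \pi_grothendieck x by rewrite reprK.
by apply/groth_pi; exists t; rewrite /= (addrC x'.2) -xt (addrC x'.1).
Qed.

Lemma groth_addA : associative groth_add.
Proof.
elim/quotW=> x; elim/quotW=> y; elim/quotW=> z.
by rewrite (groth_add_pi y) (groth_add_pi x y) !groth_add_pi /= !addrA.
Qed.

Lemma groth_addC : commutative groth_add.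
Proof.
elim/quotW=> x; elim/quotW=> y; rewrite groth_add_pi.
by rewrite (groth_add_pi y) (addrC x.1) (addrC x.2).
Qed.

Lemma groth_add0 : left_id (\pi_grothendieck (0, 0)) groth_add.
Proof. by elim/quotW=> -[x y]; rewrite groth_add_pi /= !add0r. Qed.

Lemma groth_addN :
  left_inverse (\pi_grothendieck (0, 0)) groth_opp groth_add.
Proof.
elim/quotW=> x; rewrite groth_opp_pi groth_add_pi /=; apply/groth_pi.
by exists 0; rewrite /= !addr0 add0r addrC.
Qed.

HB.instance Definition _ := GRing.isZmodule.Build grothendieck
  groth_addA groth_addC groth_add0 groth_addN.

End Grothendieck.

Definition K0 (C : numClosedFieldType) (S : starAlg C) : zmodType :=
  grothendieck (Vmonoid S).

Section CstarTheory.
Variables (R : realType) (A : cstarAlg R).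
Implicit Types x y h : A.

Lemma cstarK : involutive (@cstar R A).
Proof. exact: (alg_starK (cstar_class A)). Qed.

Lemma cstarD : {morph @cstar R A : x y / x + y}.
Proof. exact: (alg_starD (cstar_class A)). Qed.

Lemma cstarM x y : cstar (x * y) = cstar y * cstar x.
Proof. exact: (alg_starM (cstar_class A)). Qed.

Lemma cstarZ (c : R[i]) x : cstar (c *: x) = Num.conj c *: cstar x.
Proof. exact: (alg_starZ (cstar_class A)). Qed.

Lemma cstar_scaleAl (c : R[i]) x y : c *: (x * y) = (c *: x) * y.
Proof. exact: (alg_scaleAl (cstar_class A)). Qed.

Lemma cstar_scaleAr (c : R[i]) x y : c *: (x * y) = x * (c *: y).
Proof. exact: (alg_scaleAr (cstar_class A)). Qed.

Lemma cstar_normM x y : `|x * y| <= `|x| * `|y|.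
Proof. exact: (@cstar_normM_subproof R A). Qed.

Lemma cstar_identity x : `|cstar x * x| = `|x| ^+ 2.
Proof. exact: (@cstar_identity_subproof R A). Qed.

Lemma cstar0 : cstar (0 : A) = 0.
Proof. by apply: (addrI (cstar 0)); rewrite -cstarD !addr0. Qed.

Lemma cstarN x : cstar (- x) = - cstar x.
Proof. by apply: (addrI (cstar x)); rewrite -cstarD !subrr cstar0. Qed.

Lemma cstar1 : cstar (1 : A) = 1.
Proof.
by have := cstarM (cstar 1 : A) 1; rewrite mulr1 cstarK mulr1 => <-.
Qed.

Lemma cstarX x n : cstar (x ^+ n) = cstar x ^+ n.
Proof.
elim: n => [|n IHn]; first by rewrite !expr0 cstar1.
by rewrite exprS exprSr cstarM IHn.
Qed.

(* The library's norm on a module over R[i] takes its (real, nonnegative)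
   values in R[i]; this is the same norm with values in R. *)
Definition rnorm x : R := complex.Re `|x|.

Lemma rnormE x : `|x| = (rnorm x)%:C.
Proof. by rewrite /rnorm RRe_real// ger0_real. Qed.

Lemma rnorm_ge0 x : 0 <= rnorm x.
Proof. by rewrite -ler0c -rnormE normr_ge0. Qed.

Lemma rnormD x y : rnorm (x + y) <= rnorm x + rnorm y.
Proof. by rewrite -lecR rmorphD /= -!rnormE ler_normD. Qed.

Lemma rnormN x : rnorm (- x) = rnorm x.
Proof. by rewrite /rnorm normrN. Qed.

Lemma rnormB x y : rnorm (x - y) <= rnorm x + rnorm y.
Proof. by rewrite -(rnormN y) rnormD. Qed.

Lemma rnormM x y : rnorm (x * y) <= rnorm x * rnorm y.
Proof. by rewrite -lecR rmorphM /= -!rnormE cstar_normM. Qed.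

Lemma rnorm_identity x : rnorm (cstar x * x) = rnorm x ^+ 2.
Proof.
by apply: (@complexI R); rewrite /= -rnormE cstar_identity rnormE -rmorphXn.
Qed.

Lemma rnormZ (r : R) x : 0 <= r -> rnorm (r%:C *: x) = r * rnorm x.
Proof.
move=> r0; apply: (@complexI R).
by rewrite /= -rnormE normrZ rnormE rmorphM /= ger0_norm // lecR.
Qed.

Lemma rnorm1 : rnorm 1 <= 1.
Proof.
have := rnorm_identity 1; rewrite cstar1 mulr1 => e.
have := rnorm_ge0 1; nra.
Qed.

Lemma rnorm_star_le x : rnorm x <= rnorm (cstar x).
Proof.
have := rnorm_identity x; have := rnormM (cstar x) x.
have := rnorm_ge0 x; have := rnorm_ge0 (cstar x); nra.
Qed.

Lemma rnorm_star x : rnorm (cstar x) = rnorm x.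
Proof.
apply/eqP; rewrite eq_le rnorm_star_le andbT.
by rewrite -[leRHS](congr1 rnorm (cstarK x)) rnorm_star_le.
Qed.

Lemma rnormX x n (r : R) : rnorm x <= r -> rnorm (x ^+ n) <= r ^+ n.
Proof.
move=> xr; elim: n => [|n IHn]; first by rewrite !expr0 rnorm1.
rewrite !exprS (le_trans (rnormM _ _))// ler_pM ?rnorm_ge0//.
Qed.

Lemma rnorm_sum (I : Type) (s : seq I) (F : I -> A) :
  rnorm (\sum_(i <- s) F i) <= \sum_(i <- s) rnorm (F i).
Proof.
elim/big_rec2 : _ => [|i y x _ xy].
  by rewrite /rnorm normr0.
by rewrite (le_trans (rnormD _ _))// lerD2l.
Qed.
End CstarTheory.

Record closed_ideal (R : realType) (A : cstarAlg R) := ClosedIdeal {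
  ideal_set : set A;
  ideal_closed : closed ideal_set;
  ideal0 : ideal_set 0;
  ideal_linear : forall (c : R[i]) (x y : A),
    ideal_set x -> ideal_set y -> ideal_set (c *: x + y);
  ideal_mull : forall a x : A, ideal_set x -> ideal_set (a * x);
  ideal_mulr : forall a x : A, ideal_set x -> ideal_set (x * a) }.

(* Closed two-sided ideals of C*-algebras are automatically self-adjoint
   (ideal_star below), which is what makes the quotient a *-algebra. *)
Section IdealStar.
Variables (R : realType) (A : cstarAlg R) (J : closed_ideal A).
Local Notation K := (ideal_set J).
Implicit Types x y h : A.

Lemma idealD x y : K x -> K y -> K (x + y).
Proof. by move=> Kx Ky; rewrite -(scale1r x); exact: ideal_linear. Qed.

Lemma idealZ (c : R[i]) x : K x -> K (c *: x).
Proof. by move=> Kx; rewrite -[_ *: _]addr0; apply: ideal_linear => //; exact: ideal0. Qed.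

Lemma idealN x : K x -> K (- x).
Proof. by move=> Kx; rewrite -scaleN1r; exact: idealZ. Qed.

Lemma idealB x y : K x -> K y -> K (x - y).
Proof. by move=> Kx Ky; apply: idealD => //; exact: idealN. Qed.

Lemma ideal_sum (I : Type) (s : seq I) (F : I -> A) :
  (forall i, K (F i)) -> K (\sum_(i <- s) F i).
Proof.
by move=> KF; apply: big_ind => //; [exact: ideal0|exact: idealD].
Qed.

Lemma ideal_approx x :
  (forall e : R, 0 < e -> exists2 y, K y & rnorm (x - y) < e) -> K x.
Proof.
move=> app; rewrite (closure_id K).1; last exact: ideal_closed.
move=> B /nbhs_ballP[e /= e0 eB].
have er : (complex.Re e)%:C = e by rewrite RRe_real// gtr0_real.
have [|y Ky xy] := app (complex.Re e); first by rewrite -ltcR er.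
exists y; split => //; apply: eB; rewrite -ball_normE /ball_/=.
by rewrite rnormE -er ltcR.
Qed.

Section Approximation.
Variables (h : A) (n : nat).
Hypotheses (Kh : K h) (hh : cstar h = h) (h_small : rnorm h <= 2^-1).
Hypothesis n_gt0 : (0 < n)%N.

Let w := h * h.
Let d : R := 2^-1 ^+ n.+1.
Let eps : A := (- w) ^+ n.+1.
Let T : A := \sum_(i < n.+1) (- w) ^+ i.

Let w_star : cstar w = w. Proof. by rewrite /w cstarM hh. Qed.

Let comm_hw : GRing.comm h w. Proof. by rewrite /GRing.comm /w mulrA. Qed.

Let w_small : rnorm w <= 2^-1.
Proof.
rewrite /w (le_trans (rnormM _ _))//; have := rnorm_ge0 h.
by move: h_small; nra.
Qed.

Let T_star : cstar T = T.
Proof.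
rewrite /T (big_morph _ (@cstarD R A) (@cstar0 R A)).
by apply: eq_bigr => i _; rewrite cstarX cstarN w_star.
Qed.

Let comm_hT : GRing.comm h T.
Proof. by apply: commr_sum => i _; apply/commrX/commrN/comm_hw. Qed.

Let comm_wT : GRing.comm w T.
Proof. by apply/commr_sym/commrM; apply/commr_sym. Qed.

Let wT : (1 + w) * T = 1 - eps.
Proof.
by rewrite -[RHS]opprB /eps subrX1 -mulNr opprB opprK.
Qed.

Let Tw : T * (1 + w) = 1 - eps.
Proof. by rewrite -wT mulrDr mulrDl mulr1 mul1r comm_wT. Qed.

Let d_ge0 : 0 <= d. Proof. by rewrite exprn_ge0// invr_ge0. Qed.

Let eps_small : rnorm eps <= d.
Proof. by apply: rnormX; rewrite rnormN. Qed.

Let one_eps : rnorm (1 - eps) <= 1 + d.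
Proof. by rewrite (le_trans (rnormB _ _))// lerD// rnorm1. Qed.

Let j : A := 'i *: h.
Let j_star : cstar j = - j.
Proof. by rewrite /j cstarZ hh conjCi scaleNr. Qed.

Let jj : j * j = - w.
Proof.
by rewrite /j -cstar_scaleAl -cstar_scaleAr scalerA -expr2 sqrCi scaleN1r.
Qed.

Let comm_jT : GRing.comm j T.
Proof. by rewrite /GRing.comm /j -cstar_scaleAl -cstar_scaleAr comm_hT. Qed.

Let u : A := (1 + j) * ((1 + j) * T).

Let u_star : cstar u = T * (1 - j) * (1 - j).
Proof. by rewrite /u !cstarM T_star !cstarD cstar1 j_star. Qed.

Let j1j : (1 - j) * (1 + j) = 1 + w.
Proof.
by rewrite mulrDl mul1r mulNr mulrDr mulr1 jj opprD opprK addrA addrK.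
Qed.

Let comm_jw : GRing.comm (1 + j) (1 + w).
Proof.
apply/commrD; first exact: commr1.
apply/commr_sym/commrD; first exact: commr1.
by rewrite -[w]opprK -jj; apply/commr_sym/commrN/commrM.
Qed.

Let uu : cstar u * u = (1 - eps) * (1 - eps).
Proof.
rewrite u_star /u -!mulrA (mulrA (1 - j) (1 + j)) j1j (mulrA (1 + w) (1 + j)).
by rewrite -comm_jw -!mulrA wT (mulrA (1 - j) (1 + j)) j1j mulrA Tw.
Qed.

Let u_small : rnorm u <= 1 + d.
Proof.
have := rnorm_identity u; rewrite uu.
have := rnormM (1 - eps) (1 - eps); have := rnorm_ge0 (1 - eps).
have := rnorm_ge0 u; move: one_eps d_ge0; nra.
Qed.

Let T4 : 4%:R%:C *: T = 2%:R%:C *: (1 - eps) + (u + cstar u).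
Proof.
have -> : cstar u = (1 - j) * ((1 - j) * T).
  have cT : GRing.comm (1 - j) T.
    by apply/commr_sym/commrB; [exact: commr1 | apply/commr_sym].
  by rewrite u_star -cT -mulrA -cT mulrA.
have sq y : (1 + y) * (1 + y) = (1 + y * y) + (y + y) :> A.
  by rewrite mulrDl mul1r mulrDr mulr1 (addrC y (y * y)) addrACA.
rewrite !rmorph_nat !scaler_nat /u !mulrA -[X in _ = _ + X]mulrDl.
rewrite !sq mulrNN jj addrACA -opprD subrr addr0 -mulr2n mulrnAl -wT.
rewrite -mulrnDl -mulrDl addrACA subrr addr0 -mulr2n mulrnAl mul1r.
by rewrite -mulrnA.
Qed.

Let T_small : rnorm T <= 1 + d.
Proof.
have := congr1 (@rnorm R A) T4; rewrite rnormZ// => T4E.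
have := rnormD (2%:R%:C *: (1 - eps)) (u + cstar u); rewrite rnormZ//.
have := rnormD u (cstar u); rewrite rnorm_star.
by move: one_eps u_small; lra.
Qed.

Let d_small : n%:R * d <= 2^-1.
Proof.
rewrite /d exprS mulrCA ger_pMr ?invr_gt0// exprVn ler_pdivrMr ?exprn_gt0//.
by rewrite mul1r -natrX ler_nat ltnW// ltn_expl.
Qed.

Let TX_small k : (k <= n)%N -> rnorm (T ^+ k) <= 2.
Proof.
move=> kn; apply: (le_trans (rnormX k T_small)).
have bern : (1 - k%:R * d) * (1 + d) ^+ k <= 1.
  elim: k {kn} => [|k IHk]; first by rewrite mul0r subr0 expr0 mulr1.
  apply: le_trans IHk; rewrite exprS mulrA ler_wpM2r//.
    by rewrite exprn_ge0// addr_ge0.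
  rewrite -natr1; have : 0 <= k%:R :> R by [].
  by move: d_ge0; nra.
have kd : k%:R * d <= 2^-1.
  by apply: le_trans d_small; rewrite ler_wpM2r// ler_nat.
have : 0 <= (1 + d) ^+ k by rewrite exprn_ge0// addr_ge0.
move: bern kd; nra.
Qed.

Let P : A := (n%:R^-1)%:C *: \sum_(k < n) T ^+ k.

Let P_star : cstar P = P.
Proof.
rewrite /P cstarZ (big_morph _ (@cstarD R A) (@cstar0 R A)).
rewrite conj_Creal ?complex_real//; congr (_ *: _).
by apply: eq_bigr => k _; rewrite cstarX T_star.
Qed.

Let comm_hP : GRing.comm h P.
Proof.
rewrite /GRing.comm /P -cstar_scaleAl -cstar_scaleAr; congr (_ *: _).
by apply: commr_sum => k _; apply: commrX.
Qed.

Let n_inv_ge0 : 0 <= n%:R^-1 :> R. Proof. by rewrite invr_ge0. Qed.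

Let P_small : rnorm P <= 2.
Proof.
rewrite rnormZ// (le_trans (ler_wpM2l _ (rnorm_sum _ _)))//.
apply: (@le_trans _ _ (n%:R^-1 * \sum_(k < n) (2 : R))).
  by rewrite ler_wpM2l// ler_sum// => k _; apply/TX_small/ltnW.
by rewrite sumr_const card_ord -(mulr_natl 2 n) mulrA mulVf ?mul1r// pnatr_eq0 -lt0n.
Qed.

Let oneT : (1 + w) * (1 - T) = w + eps.
Proof. by rewrite mulrBr mulr1 wT opprB addrC addrA subrK addrC. Qed.

Let K_eps : K eps.
Proof. by rewrite /eps exprS; apply/ideal_mulr/idealN/ideal_mulr. Qed.

Let K1T : K (1 - T).
Proof.
have -> : 1 - T = w * T + eps.
  by apply/eqP; rewrite subr_eq addrAC -{2}(mul1r T) -mulrDl (addrC w) wT subrK.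
by apply: idealD => //; apply/ideal_mulr/ideal_mulr.
Qed.

Let K1P : K (1 - P).
Proof.
have -> : 1 - P = (n%:R^-1)%:C *: \sum_(k < n) (1 - T ^+ k).
  rewrite sumrB sumr_const card_ord scalerBr; congr (_ - _).
  rewrite -(@scaler_nat R[i]) scalerA -(rmorph_nat (real_complex R)) -rmorphM/=.
  by rewrite mulVf ?scale1r// pnatr_eq0 -lt0n.
apply/idealZ/ideal_sum => k.
by rewrite -opprB subrX1 -mulNr opprB; apply: ideal_mulr.
Qed.

Let wP : w * P = (1 + w) * ((n%:R^-1)%:C *: (1 - T ^+ n)) - eps * P.
Proof.
have -> : (n%:R^-1)%:C *: (1 - T ^+ n) = (1 - T) * P.
  by rewrite /P -cstar_scaleAr -(opprB (T ^+ n)) subrX1 -mulNr opprB.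
by rewrite mulrA oneT mulrDl addrK.
Qed.

Lemma ideal_approx_unit : exists P,
  [/\ K (1 - P), cstar P = P, GRing.comm h P, rnorm P <= 2 &
      rnorm (h * h * P) <= 7 / n%:R].
Proof.
exists P; split => //; rewrite -/w wP.
pose Y : A := (n%:R^-1)%:C *: (1 - T ^+ n); rewrite -/Y.
have n0 : 0 < n%:R^-1 :> R by rewrite invr_gt0 ltr0n.
have d1 : d <= n%:R^-1 / 2.
  by rewrite ler_pdivlMl ?ltr0n.
have w2 : rnorm (1 + w) <= 2.
  apply: (le_trans (rnormD _ _)); rewrite (_ : 2 = 1 + 1 :> R)//.
  by rewrite lerD ?rnorm1// (le_trans w_small)// invf_le1// ler1n.
have Y3 : rnorm Y <= n%:R^-1 * 3.
  rewrite rnormZ// ler_wpM2l// (le_trans (rnormB _ _))//.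
  by rewrite (_ : 3 = 1 + 2 :> R) ?lerD ?rnorm1 ?TX_small// -natrD.
have a1 : rnorm ((1 + w) * Y) <= 2 * (n%:R^-1 * 3).
  by rewrite (le_trans (rnormM _ _))// ler_pM ?rnorm_ge0.
have a2 : rnorm (eps * P) <= n%:R^-1 / 2 * 2.
  by rewrite (le_trans (rnormM _ _))// ler_pM ?rnorm_ge0// (le_trans eps_small).
apply: (le_trans (rnormB _ _)); apply: (le_trans (lerD a1 a2)).
by rewrite divfK// mulrCA -natrM -[X in _ + X]mulr1 -mulrDr natr1 mulrC.
Qed.

End Approximation.

Lemma ideal_star_small x : K x -> rnorm (x * cstar x) <= 2^-1 -> K (cstar x).
Proof.
move=> Kx xs; apply: ideal_approx => e e0.
have [h hE] : exists h, h = x * cstar x by eexists.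
have Kh : K h by rewrite hE; apply: ideal_mulr.
have hh : cstar h = h by rewrite hE cstarM cstarK.
rewrite -hE in xs.
pose n := (Num.bound (56 / e ^+ 4)).+1.
have nE : 56 / e ^+ 4 < n%:R.
  apply: (@lt_trans _ _ (Num.bound (56 / e ^+ 4))%:R); last by rewrite ltr_nat.
  by rewrite archi_boundP// divr_ge0// exprn_ge0// ltW.
have [//|P [K1P Ps cP P2 w7]] := @ideal_approx_unit h n Kh hh xs.
exists (cstar x * (1 - P)); first exact: ideal_mull.
rewrite mulrBr mulr1 opprB addrCA subrr addr0.
have e1 := rnorm_identity (cstar x * P).
have e2 := rnorm_identity (h * P).
have E1 : cstar (cstar x * P) * (cstar x * P) = h * P * P.
  by rewrite cstarM cstarK Ps mulrA -(mulrA P) -hE -cP.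
have E2 : cstar (h * P) * (h * P) = h * h * P * P.
  by rewrite cstarM hh Ps -cP -!mulrA (mulrA P h) -cP -!mulrA.
rewrite E1 in e1; rewrite E2 in e2.
have := rnormM (h * P) P; have := rnormM (h * h * P) P.
have := rnorm_ge0 (h * P); have := rnorm_ge0 (h * h * P).
have := rnorm_ge0 P; have := rnorm_ge0 (cstar x * P).
move: e1 e2 P2 w7; move: (rnorm (cstar x * P)) => a.
move: (rnorm (h * P)) (rnorm (h * h * P)) (rnorm P) => b c p.
move: (rnorm (h * P * P)) (rnorm (h * h * P * P)) => f g.
move=> -> -> p2 c7 a0 p0 c0 b0 le1 le2.
have b2 : b ^+ 2 <= 2 * c by nra.
have a2 : a ^+ 2 <= 2 * b by nra.
have a4 : a ^+ 4 <= 56 / n%:R.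
  have : (a ^+ 2) ^+ 2 <= (2 * b) ^+ 2 by rewrite ler_sqr ?nnegrE; nra.
  by rewrite -exprM exprMn; lra.
rewrite ltNge; apply/negP => ea.
have : e ^+ 4 <= a ^+ 4 by rewrite lerXn2r ?nnegrE// ltW.
move: nE; rewrite ltr_pdivrMr ?exprn_gt0// => nE ea4.
have := le_trans ea4 a4; rewrite ler_pdivlMr ?ltr0n//.
by rewrite leNgt mulrC nE.
Qed.

Lemma ideal_star x : K x -> K (cstar x).
Proof.
move=> Kx; set m := rnorm (x * cstar x) + 1.
have m0 : 0 < m by rewrite ltr_wpDl// rnorm_ge0.
have m1 : 1 <= m by rewrite lerDr rnorm_ge0.
pose c : R := (2 * m)^-1.
have c0 : 0 < c by rewrite invr_gt0 mulr_gt0.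
have sc : cstar (c%:C *: x) = c%:C *: cstar x.
  by rewrite cstarZ conj_Creal ?complex_real.
have : K (cstar (c%:C *: x)).
  apply: ideal_star_small; first exact: idealZ.
  rewrite sc -cstar_scaleAl -cstar_scaleAr !rnormZ ?ltW//.
  have c1 : c * m = 2^-1 by rewrite /c invfM -mulrA mulVf ?mulr1 ?gt_eqF.
  have : rnorm (x * cstar x) <= m by rewrite lerDl.
  have := rnorm_ge0 (x * cstar x); nra.
rewrite sc => /(idealZ (c^-1)%:C); rewrite scalerA -rmorphM/= mulVf ?gt_eqF//.
by rewrite scale1r.
Qed.

End IdealStar.

Section QuotientAlgebra.
Variables (R : realType) (A : cstarAlg R) (J : closed_ideal A).
Local Notation K := (ideal_set J).
Implicit Types (x y : A) (c : R[i]).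

Definition ideal_pred : {pred A} := fun x => `[< K x >].

Lemma ideal_pred_zmod : zmod_closed ideal_pred.
Proof.
split=> [|x y /asboolP Kx /asboolP Ky]; apply/asboolP; first exact: ideal0.
exact: idealB.
Qed.

HB.instance Definition _ := GRing.isZmodClosed.Build A ideal_pred ideal_pred_zmod.

Definition quot_sort : Type := Quotient.quot ideal_pred.
HB.instance Definition _ := GRing.Zmodule.on quot_sort.

Definition quot_pi (x : A) : quot_sort := \pi_(Quotient.quot ideal_pred) x.
Definition quot_repr (a : quot_sort) : A := repr (a : Quotient.quot ideal_pred).

Lemma quot_reprK a : quot_pi (quot_repr a) = a.
Proof. exact: reprK. Qed.

Lemma quot_piP x y : quot_pi x = quot_pi y <-> K (x - y).
Proof.
split=> [/eqP|Kxy].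
  by rewrite /quot_pi -Quotient.idealrBE => /asboolP.
by apply/eqP; rewrite /quot_pi -Quotient.idealrBE; apply/asboolP.
Qed.

Lemma quot_piD x y : quot_pi (x + y) = quot_pi x + quot_pi y.
Proof. exact: (raddfD (\pi_(Quotient.quot ideal_pred))). Qed.

Definition quot_scale c (a : quot_sort) := quot_pi (c *: quot_repr a).
Definition quot_mul (a b : quot_sort) := quot_pi (quot_repr a * quot_repr b).
Definition quot_star (a : quot_sort) := quot_pi (cstar (quot_repr a)).

Lemma quot_reprP x : K (quot_repr (quot_pi x) - x).
Proof. by apply/quot_piP; rewrite quot_reprK. Qed.

Lemma quot_piZ c x : quot_pi (c *: x) = quot_scale c (quot_pi x).
Proof.
by apply/esym/quot_piP; rewrite -scalerBr; apply/idealZ/quot_reprP.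
Qed.

Lemma quot_piM x y : quot_pi (x * y) = quot_mul (quot_pi x) (quot_pi y).
Proof.
apply/esym/quot_piP; set x' := quot_repr _; set y' := quot_repr _.
have -> : x' * y' - x * y = (x' - x) * y' + x * (y' - y).
  by rewrite mulrBl mulrBr addrA subrK.
by apply: idealD; [apply: ideal_mulr|apply: ideal_mull]; exact: quot_reprP.
Qed.

Lemma quot_pi_star x : quot_pi (cstar x) = quot_star (quot_pi x).
Proof.
apply/esym/quot_piP; rewrite -cstarN -cstarD.
exact/ideal_star/quot_reprP.
Qed.

Lemma quot_elim (P : quot_sort -> Prop) : (forall x, P (quot_pi x)) -> forall a, P a.
Proof. by move=> Px a; rewrite -(quot_reprK a). Qed.

Lemma quot_scaleA c d a : quot_scale c (quot_scale d a) = quot_scale (c * d) a.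
Proof. by elim/quot_elim: a => x; rewrite -!quot_piZ scalerA. Qed.

Lemma quot_scale1 : left_id 1 quot_scale.
Proof. by elim/quot_elim=> x; rewrite -quot_piZ scale1r. Qed.

Lemma quot_scaleDr : right_distributive quot_scale +%R.
Proof.
move=> c; elim/quot_elim=> x; elim/quot_elim=> y.
by rewrite -quot_piD -!quot_piZ -quot_piD scalerDr.
Qed.

Lemma quot_scaleDl a : {morph quot_scale^~ a : c d / c + d}.
Proof.
by move=> c d; elim/quot_elim: a => x; rewrite -!quot_piZ -quot_piD scalerDl.
Qed.

HB.instance Definition _ := GRing.Zmodule_isLmodule.Build R[i] quot_sort
  quot_scaleA quot_scale1 quot_scaleDr quot_scaleDl.

Lemma quot_piZE c x : quot_pi (c *: x) = c *: quot_pi x.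
Proof. exact: quot_piZ. Qed.

Lemma quot_mulA : associative quot_mul.
Proof.
elim/quot_elim=> x; elim/quot_elim=> y; elim/quot_elim=> z.
by rewrite -!quot_piM mulrA.
Qed.

Lemma quot_mul1r : left_id (quot_pi 1) quot_mul.
Proof. by elim/quot_elim=> x; rewrite -quot_piM mul1r. Qed.

Lemma quot_mulr1 : right_id (quot_pi 1) quot_mul.
Proof. by elim/quot_elim=> x; rewrite -quot_piM mulr1. Qed.

Lemma quot_mulDl : left_distributive quot_mul +%R.
Proof.
elim/quot_elim=> x; elim/quot_elim=> y; elim/quot_elim=> z.
by rewrite -quot_piD -!quot_piM -quot_piD mulrDl.
Qed.

Lemma quot_mulDr : right_distributive quot_mul +%R.
Proof.
elim/quot_elim=> x; elim/quot_elim=> y; elim/quot_elim=> z.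
by rewrite -quot_piD -!quot_piM -quot_piD mulrDr.
Qed.

Lemma quot_scaleAl c (a b : quot_sort) :
  c *: quot_mul a b = quot_mul (c *: a) b.
Proof.
elim/quot_elim: a => x; elim/quot_elim: b => y.
by rewrite -quot_piZE -!quot_piM -quot_piZE cstar_scaleAl.
Qed.

Lemma quot_scaleAr c (a b : quot_sort) :
  c *: quot_mul a b = quot_mul a (c *: b).
Proof.
elim/quot_elim: a => x; elim/quot_elim: b => y.
by rewrite -quot_piZE -!quot_piM -quot_piZE cstar_scaleAr.
Qed.

Lemma quot_starK : involutive quot_star.
Proof. by elim/quot_elim=> x; rewrite -!quot_pi_star cstarK. Qed.

Lemma quot_starD : {morph quot_star : a b / a + b}.
Proof.
elim/quot_elim=> x; elim/quot_elim=> y.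
by rewrite -quot_piD -!quot_pi_star -quot_piD cstarD.
Qed.

Lemma quot_starM a b :
  quot_star (quot_mul a b) = quot_mul (quot_star b) (quot_star a).
Proof.
elim/quot_elim: a => x; elim/quot_elim: b => y.
by rewrite -quot_piM -!quot_pi_star -quot_piM cstarM.
Qed.

Lemma quot_starZ c (a : quot_sort) :
  quot_star (c *: a) = Num.conj c *: quot_star a.
Proof.
by elim/quot_elim: a => x; rewrite -quot_piZE -!quot_pi_star -quot_piZE cstarZ.
Qed.

(* A / J as a unital *-algebra. Its norm is not recorded: neither
   *-isomorphisms nor K0 refer to it. *)
Definition quotient_algebra : starAlg R[i] :=
  StarAlg (StarAlgebraOn quot_mulA quot_mul1r quot_mulr1 quot_mulDl quot_mulDr
    quot_scaleAl quot_scaleAr quot_starK quot_starD quot_starM quot_starZ).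

End QuotientAlgebra.

Definition star_isomorphic (C : numClosedFieldType) (S T : starAlg C) : Prop :=
  exists f : S -> T, [/\ bijective f, linear f,
    {morph f : x y / x * y} & {morph f : x / star x}].

Definition separable_space (T : topologicalType) : Prop :=
  exists2 D : set T, countable D & dense D.

(* Quotients of a unital algebra are unital, so only unital algebras B (those
   covered by cstarAlg) can be required to be quotients of A. *)
Definition quotient_generator (R : realType) (A : cstarAlg R) : Prop :=
  forall B : cstarAlg R, separable_space B ->
    exists K : closed_ideal A, star_isomorphic B (quotient_algebra K).

Definition dist_to (R : realType) (A : cstarAlg R) (x : A)
    (K : closed_ideal A) : R :=
  inf [set rnorm (x - y) | y in ideal_set K].

Section Wijsman.
Variables (R : realType) (A : cstarAlg R).
HB.instance Definition _ := gen_eqMixin (closed_ideal A).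
HB.instance Definition _ := gen_choiceMixin (closed_ideal A).
(* the Wijsman topology *)
HB.instance Definition _ := Topological.copy (closed_ideal A)
  (sup_topology (fun x : A =>
     Topological.on (initial_topology (@dist_to R A x)))).
End Wijsman.

Record subgroup (V : zmodType) := Subgroup {
  subgroup_mem :> V -> bool;
  subgroup_zmod_closed : zmod_closed subgroup_mem }.

Section SubgroupTopology.
Variable V : zmodType.
HB.instance Definition _ := gen_eqMixin (subgroup V).
HB.instance Definition _ := gen_choiceMixin (subgroup V).
(* the subspace topology inherited from the Cantor space 2^V *)
Definition subgroup_incl (H : subgroup V) : prod_topology (fun _ : V => bool) :=
  subgroup_mem H.
HB.instance Definition _ := Topological.copy (subgroup V) (initial_topology subgroup_incl).
End SubgroupTopology.

Definition subgroup_pred (V : zmodType) (H : subgroup V) : {pred V} := subgroup_mem H.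
HB.instance Definition _ (V : zmodType) (H : subgroup V) :=
  GRing.isZmodClosed.Build V (subgroup_pred H) (subgroup_zmod_closed H).

Definition quotient_group (V : zmodType) (H : subgroup V) : zmodType :=
  Quotient.quot (subgroup_pred H).

Definition group_isomorphic (U V : zmodType) : Prop :=
  exists f : {additive U -> V}, bijective f.

Definition borel_sets (T : topologicalType) : set (set T) := <<s @open T >>.

Definition borel_map (T U : topologicalType) (f : T -> U) : Prop :=
  forall B : set U, borel_sets B -> borel_sets (f @^-1` B).

Definition Zfin : zmodType := {freeg nat / int}.

(* Main.v *)
Require Import Defs.
From HB Require Import structures.
From mathcomp Require Import all_boot all_order all_algebra.
From mathcomp Require Import all_classical all_reals all_analysis.
From mathcomp Require Import borel_hierarchy generic_quotient ring_quotient.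
From mathcomp Require Import complex freeg ssrAC.
From mathcomp Require Import lra ring.

Set Implicit Arguments.
Unset Strict Implicit.
Unset Printing Implicit Defensive.

Import Order.TTheory GRing.Theory Num.Theory.
Import numFieldNormedType.Exports.

Local Open Scope classical_set_scope.
Local Open Scope ring_scope.
Local Open Scope complex_scope.
Local Open Scope quotient_scope.

(* Fix a dense sequence of A. A code (n, c, l) names an n x n matrix a over that
   sequence and a norm bound l; in A / K it represents any projection p with
   |p| < l that is close enough to a. Closeness is chosen so that all
   projections represented by a code are Murray-von Neumann equivalent, and every
   projection over A / K is represented by some code. Hence K0 (A / K) is
   presented by the codes, subject to the relators e_i + e_j - e_k whenever
   p_i + p_j ~ p_k, together with e_i for the codes that represent nothing.

   The relation p_i + p_j ~ p_k is stable under small perturbations of K: lift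
   the projections and the partial isometry to A; the finitely many inequalities
   d(x, K) < r saying that the lifts are approximate solutions persist, and
   Newton iterations turn approximate solutions into exact ones in the nearby
   quotient. Separability makes such sets countable unions of basic closed sets.

   Matrices carry the sum of the quotient norms of their entries. This is not a
   C*-norm, but the Newton iterations only use that it is a complete
   submultiplicative norm with isometric involution. *)

(** * Geometric sequences and the Newton step for idempotents *)

Lemma ltr_geom2 (R : realType) (c e : R) : 0 < e ->
  exists k, c / 2 ^+ k < e.
Proof.
move=> e0; have [c0|c0] := leP c 0.
  by exists 0%N; rewrite expr0 divr1 (le_lt_trans c0).
exists (Num.bound (c / e)); rewrite ltr_pdivrMr ?exprn_gt0// mulrC.
rewrite -ltr_pdivrMr//.
apply: (lt_trans (archi_boundP _)); first by rewrite divr_ge0// ltW.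
by rewrite -natrX ltr_nat ltn_expl.
Qed.

Lemma le0_geom2 (R : realType) (c x : R) : 0 <= x ->
  (forall k, x <= c / 2 ^+ k) -> x = 0.
Proof.
move=> x0 xc; apply/eqP; rewrite eq_le x0 andbT leNgt; apply/negP => xgt0.
by have [k] := ltr_geom2 c xgt0; rewrite ltNge xc.
Qed.

Lemma geom2S (R : realType) (c : R) k : c / 2 ^+ k.+1 = c / 2 ^+ k / 2.
Proof. by rewrite exprSr invfM mulrA. Qed.

Lemma geom2_cauchy (R : realType) (V : zmodType) (N : V -> R) :
  N 0 = 0 -> (forall x, N (- x) = N x) -> (forall x y, N (x + y) <= N x + N y) ->
  forall (u : nat -> V) (c : R), 0 <= c ->
  (forall k, N (u k.+1 - u k) <= c / 2 ^+ k) ->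
  forall k j, N (u k - u (k + j)%N) <= 2 * c / 2 ^+ k.
Proof.
move=> N0 NN ND u c c0 uc k j.
(* Subtracting the tail that is still to come makes the induction on [j] close exactly. *)
suff : N (u k - u (k + j)%N) <= 2 * c / 2 ^+ k - 2 * c / 2 ^+ (k + j).
  have : 0 <= 2 * c / 2 ^+ (k + j) by rewrite divr_ge0 ?exprn_ge0// mulr_ge0.
  by lra.
elim: j => [|j IHj]; first by rewrite addn0 !subrr N0.
have := ND (u k - u (k + j)%N) (u (k + j)%N - u (k + j.+1)%N).
rewrite subrKA => /le_trans; apply.
have := uc (k + j)%N; rewrite -NN opprB addnS !geom2S; move: IHj.
have -> : 2 * c / 2 ^+ (k + j) = c / 2 ^+ (k + j) * 2.
  by rewrite mulrAC mulrC mulrA mulrAC.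
by lra.
Qed.

(* Here y = 3 x^2 - 2 x^3: the step squares the defect x^2 - x. *)
Lemma newton_idempotent (W : pzRingType) (x : W) :
  let e := x * x - x in let y := x - (x + x - 1) * e in
  y * y - y = e * e * e *+ 4 - e * e *+ 3.
Proof.
(* All terms are polynomials in [x], hence commute; the calculation runs in [t] and [e], with
   [t^2 = 4 e + 1]. *)
have [t tE] : exists t, t = x + x - 1 by eexists.
rewrite /= -tE; have [e eE] : exists e, e = x * x - x by eexists.
rewrite -eE.
have xx : x * x = e + x by rewrite eE subrK.
have tx : t * x = e + e + x.
  by rewrite tE mulrBl mul1r mulrDl xx addrA addrK addrAC.
have xt : x * t = t * x by rewrite tE mulrBl mulrBr mulr1 mul1r mulrDl mulrDr.
have xe : x * e = e * x by rewrite eE mulrBl mulrBr mulrA.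
have te : e * t = t * e.
  by rewrite tE mulrBl mulrBr mulr1 mul1r mulrDl mulrDr xe.
have e4 : e + e + (e + e) = e *+ 4 by rewrite -!mulr2n -mulrnA.
have tt : t * t = e *+ 4 + 1.
  rewrite {2}tE mulrBr mulr1 mulrDr tx addrACA e4 -addrA.
  by rewrite tE opprB (addrC 1) addNKr.
have [f fE] : exists f, f = t * x * e by eexists.
have teE : t * e = f + f - e * e *+ 4 - e.
  rewrite fE tx mulrDl addrACA -mulrDl e4 mulrnAl [_ *+ 4 + _]addrC addrK.
  by rewrite -mulrDl tE mulrBl mul1r.
have teX : t * e * (t * e) = e * e * e *+ 4 + e * e.
  rewrite -mulrA (mulrA e) te !mulrA tt -(mulrA _ e) mulrDl mul1r mulrnAl.
  by rewrite mulrA.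
have -> : e * e * e *+ 4 - e * e *+ 3 = (e * e * e *+ 4 + e * e) - e * e *+ 4.
  by rewrite (mulrSr (e * e) 3) (opprD (_ *+ 3) (e * e)) addrACA subrr addr0.
rewrite mulrBl !mulrBr teX mulrA xt -fE.
rewrite -(mulrA t e x) -xe (mulrA t x) -fE xx teE.
move: (e * e * e *+ 4) (e * e *+ 4) => G h.
rewrite !opprB !addrA [LHS](ACl ((4*5*9)*(1*10)*(2*11)*(7*3)*(8*6)))/=.
by rewrite !subrr !addr0.
Qed.

(* Completeness is stated for geometrically convergent sequences, the only ones
   produced by the Newton iterations below. *)
Record banach_star_norm (R : realType) (S : starAlg R[i]) (N : S -> R) : Prop :=
  BanachStarNorm {
  bnorm_eq0 : forall x, N x = 0 -> x = 0;
  bnorm0 : N 0 = 0;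
  bnormN : forall x, N (- x) = N x;
  bnormD : forall x y, N (x + y) <= N x + N y;
  bnormM : forall x y, N (x * y) <= N x * N y;
  bnorm_star : forall x, N (star x) = N x;
  bnorm_half : forall x, N ((2^-1 : R)%:C *: x) = N x / 2;
  bnorm_complete : forall (u : nat -> S) (c : R), 0 < c ->
    (forall k, N (u k.+1 - u k) <= c / 2 ^+ k) ->
    exists l, forall k, N (u k - l) <= 4 * c / 2 ^+ k }.

(** * Matrices over a star-algebra and their entrywise sum norm *)

Definition mxnorm (R : realType) (T : Type) (N : T -> R) m n (M : 'M[T]_(m, n)) : R :=
  \sum_i \sum_j N (M i j).

(** Entrywise, since [*:] on matrices over [S] scales by elements of [S], not by complex numbers. *)
Definition mxhalf (R : realType) (S : starAlg R[i]) m n (M : 'M[S]_(m, n)) :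
  'M[S]_(m, n) := map_mx (fun x : S => (2^-1 : R)%:C *: x) M.

Section MatrixStar.
Variables (R : realType) (S : starAlg R[i]).
Implicit Types m n k : nat.

Lemma mxstarD m n (M N : 'M[S]_(m, n)) : mxstar (M + N) = mxstar M + mxstar N.
Proof. by apply/matrixP => i j; rewrite !mxE starD. Qed.

Lemma mxstarN m n (M : 'M[S]_(m, n)) : mxstar (- M) = - mxstar M.
Proof. by apply: (addrI (mxstar M)); rewrite -mxstarD !subrr mxstar0. Qed.

Lemma mxstarB m n (M N : 'M[S]_(m, n)) : mxstar (M - N) = mxstar M - mxstar N.
Proof. by rewrite mxstarD mxstarN. Qed.

Lemma mxhalf_star m n (M : 'M[S]_(m, n)) : mxstar (mxhalf M) = mxhalf (mxstar M).
Proof.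
apply/matrixP => i j; rewrite !mxE starZ; congr (_ *: _).
by rewrite conj_Creal ?complex_real.
Qed.

Lemma mxhalfD m n (M N : 'M[S]_(m, n)) : mxhalf (M + N) = mxhalf M + mxhalf N.
Proof. by apply/matrixP => i j; rewrite !mxE scalerDr. Qed.

Lemma mxhalf2 m n (M : 'M[S]_(m, n)) : mxhalf M + mxhalf M = M.
Proof.
apply/matrixP => i j; rewrite !mxE -scalerDl -rmorphD/= -[RHS]scale1r.
by congr (_ *: _); rewrite -(rmorph1 (real_complex R)); congr (_%:C); lra.
Qed.

Lemma mxhalfMl m n k (M : 'M[S]_(m, n)) (N : 'M[S]_(n, k)) :
  mxhalf M *m N = mxhalf (M *m N).
Proof.
apply/matrixP => i j; rewrite !mxE scaler_sumr; apply: eq_bigr => l _.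
by rewrite mxE; apply/esym/(alg_scaleAl (star_class S)).
Qed.

Lemma mxhalfMr m n k (M : 'M[S]_(m, n)) (N : 'M[S]_(n, k)) :
  M *m mxhalf N = mxhalf (M *m N).
Proof.
apply/matrixP => i j; rewrite !mxE scaler_sumr; apply: eq_bigr => l _.
by rewrite mxE; apply/esym/(alg_scaleAr (star_class S)).
Qed.

End MatrixStar.

Section MatrixNorm.
Variables (R : realType) (S : starAlg R[i]) (N : S -> R).
Hypothesis HN : banach_star_norm N.
Implicit Types m n : nat.
Local Notation D := (mxnorm N).

Lemma bnorm_ge0 x : 0 <= N x.
Proof.
have := bnormD HN x (- x); rewrite subrr (bnorm0 HN) (bnormN HN); lra.
Qed.

Lemma bnorm_sum (I : Type) (s : seq I) (F : I -> S) :
  N (\sum_(i <- s) F i) <= \sum_(i <- s) N (F i).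
Proof.
elim/big_rec2 : _ => [|i y x _ xy]; first by rewrite (bnorm0 HN).
by rewrite (le_trans (bnormD HN _ _))// lerD2l.
Qed.

Lemma mxnorm_ge0 m n (M : 'M[S]_(m, n)) : 0 <= D M.
Proof. by do 2 (apply: sumr_ge0 => ? _); exact: bnorm_ge0. Qed.

Lemma mxnorm0 m n : D (0 : 'M[S]_(m, n)) = 0.
Proof. by do 2 (apply: big1 => ? _); rewrite mxE (bnorm0 HN). Qed.

Lemma mxnormN m n (M : 'M[S]_(m, n)) : D (- M) = D M.
Proof. by do 2 (apply: eq_bigr => ? _); rewrite mxE (bnormN HN). Qed.

Lemma mxnormD m n (M M' : 'M[S]_(m, n)) : D (M + M') <= D M + D M'.
Proof.
rewrite -big_split/=; apply: ler_sum => i _; rewrite -big_split/=.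
by apply: ler_sum => j _; rewrite mxE (bnormD HN).
Qed.

Lemma mxnormB m n (M M' : 'M[S]_(m, n)) : D (M - M') <= D M + D M'.
Proof. by rewrite -(mxnormN M') mxnormD. Qed.

Lemma mxnormBC m n (M M' : 'M[S]_(m, n)) : D (M - M') = D (M' - M).
Proof. by rewrite -mxnormN opprB. Qed.

Lemma mxnormB_trans m n (M' M M'' : 'M[S]_(m, n)) :
  D (M - M'') <= D (M - M') + D (M' - M'').
Proof. by rewrite -[M - _](subrKA M') mxnormD. Qed.

Lemma mxnorm_eq0 m n (M : 'M[S]_(m, n)) : D M = 0 -> M = 0.
Proof.
move=> M0; apply/matrixP => i j; rewrite mxE; apply: (bnorm_eq0 HN).
have P0 k : true -> 0 <= \sum_j N (M k j).
  by move=> _; apply: sumr_ge0 => l _; apply: bnorm_ge0.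
have /(_ i isT) Mi := psumr_eq0P P0 M0.
by apply: (psumr_eq0P _ Mi) => // l _; apply: bnorm_ge0.
Qed.

Lemma mxnormB_eq0 m n (M M' : 'M[S]_(m, n)) : D (M - M') = 0 -> M = M'.
Proof. by move=> /mxnorm_eq0/eqP; rewrite subr_eq0 => /eqP. Qed.

Lemma mxnorm_entry m n (M : 'M[S]_(m, n)) i j : N (M i j) <= D M.
Proof.
rewrite /mxnorm (bigD1 i)//= (bigD1 j)//= -addrA lerDl addr_ge0//.
  by apply: sumr_ge0 => ? _; apply: bnorm_ge0.
by do 2 (apply: sumr_ge0 => ? _); apply: bnorm_ge0.
Qed.

Lemma mxnormM m n k (M : 'M[S]_(m, n)) (M' : 'M[S]_(n, k)) :
  D (M *m M') <= D M * D M'.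
Proof.
rewrite /mxnorm mulr_suml; apply: ler_sum => i _; rewrite mulr_suml.
apply: (@le_trans _ _ (\sum_l \sum_j N (M i j) * N (M' j l))).
  apply: ler_sum => l _; rewrite mxE (le_trans (bnorm_sum _ _))//.
  by apply: ler_sum => j _; apply: bnormM.
rewrite exchange_big/=; apply: ler_sum => j _; rewrite -mulr_sumr.
rewrite ler_wpM2l ?bnorm_ge0// [leRHS](bigD1 j)//= lerDl.
by do 2 (apply: sumr_ge0 => ? _); apply: bnorm_ge0.
Qed.

Lemma mxnormM_le m n k (M : 'M[S]_(m, n)) (M' : 'M[S]_(n, k)) a b :
  D M <= a -> D M' <= b -> D (M *m M') <= a * b.
Proof. by move=> Ma Mb; rewrite (le_trans (mxnormM _ _))// ler_pM ?mxnorm_ge0. Qed.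

Lemma mxnorm_star m n (M : 'M[S]_(m, n)) : D (mxstar M) = D M.
Proof.
rewrite /mxnorm exchange_big/=; do 2 (apply: eq_bigr => ? _).
by rewrite !mxE (bnorm_star HN).
Qed.

Lemma mxnorm_half m n (M : 'M[S]_(m, n)) : D (mxhalf M) = D M / 2.
Proof.
rewrite /mxnorm mulr_suml; apply: eq_bigr => i _; rewrite mulr_suml.
by apply: eq_bigr => j _; rewrite mxE (bnorm_half HN).
Qed.

Lemma mxnorm_block_diag m n (M : 'M[S]_m) (M' : 'M[S]_n) :
  D (block_mx M 0 0 M') = D M + D M'.
Proof.
rewrite /mxnorm big_split_ord/=; congr (_ + _); apply: eq_bigr => i _.
  rewrite big_split_ord/= [X in _ + X]big1 ?addr0 => [|j _].
    by apply: eq_bigr => j _; rewrite block_mxEul.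
  by rewrite block_mxEur mxE (bnorm0 HN).
rewrite big_split_ord/= [X in X + _]big1 ?add0r => [|j _].
  by apply: eq_bigr => j _; rewrite block_mxEdr.
by rewrite block_mxEdl mxE (bnorm0 HN).
Qed.

(** Entrywise limits only give a bound that depends on the matrix size. It is applied at a late
    index, where it is below any [e]; the Cauchy estimate leads back to [k], so the final constant
    is free of [m] and [n]. *)
Lemma mx_geom_limit m n (u : nat -> 'M[S]_(m, n)) (c : R) : 0 < c ->
  (forall k, D (u k.+1 - u k) <= c / 2 ^+ k) ->
  exists l, forall k, D (u k - l) <= 2 * c / 2 ^+ k.
Proof.
move=> c0 uc.
have ex (ij : 'I_m * 'I_n) : exists l, forall k,
    N (u k ij.1 ij.2 - l) <= 4 * c / 2 ^+ k.
  apply: (bnorm_complete HN c0) => k; apply: le_trans (uc k).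
  by have := mxnorm_entry (u k.+1 - u k) ij.1 ij.2; rewrite !mxE.
have [l lP] := choice ex.
pose L : 'M[S]_(m, n) := \matrix_(i, j) l (i, j).
have uL k : D (u k - L) <= (\sum_(i < m) \sum_(j < n) 4 * c) / 2 ^+ k.
  rewrite mulr_suml; apply: ler_sum => i _; rewrite mulr_suml.
  by apply: ler_sum => j _; have := lP (i, j) k; rewrite /= !mxE.
exists L => k; apply/ler_addgt0Pr => e e0.
have [j je] := ltr_geom2 (\sum_(i < m) \sum_(j < n) 4 * c) e0.
apply: (le_trans (mxnormB_trans (u (k + j)%N) _ _)).
apply: lerD.
  by apply: (@geom2_cauchy R _ (@mxnorm R S N m n) (mxnorm0 m n) (@mxnormN m n)
    (@mxnormD m n)) => //; exact: ltW.
apply: (le_trans (uL _)); apply: le_trans (ltW je).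
apply: ler_wpM2l; first by do 2 (apply: sumr_ge0 => ? _); rewrite mulr_ge0// ltW.
by rewrite lef_pV2 ?posrE ?exprn_gt0// ler_eXn2l ?ltr1n// leq_addl.
Qed.
End MatrixNorm.

(** * Approximate projections are close to projections *)

Section Newton.
Variables (R : realType) (S : starAlg R[i]) (N : S -> R).
Hypothesis HN : banach_star_norm N.
Implicit Types m n : nat.
Local Notation D := (mxnorm N).

(** Iterate the Newton step. For a defect [e] of norm at most 1/8, [4 e^3 - 3 e^2] has at most half
    that norm, so the defects decay geometrically and the [k]-th move is at most [c / 2^k]. The
    moves add up to at most [2 c <= 1], which keeps all iterates below [M + 1]. *)
Lemma projection_near n (x : 'M[S]_n) (M d : R) :
  mxstar x = x -> D x <= M -> D (x *m x - x) <= d -> 0 < d -> d <= 8^-1 ->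
  2 * (d * (2 * M + 3)) <= 1 ->
  exists p : 'M[S]_n, [/\ p *m p = p, mxstar p = p &
    D (x - p) <= 2 * (d * (2 * M + 3))].
Proof.
move=> xs xM xd d0 d8 dM.
have M0 : 0 <= M := le_trans (mxnorm_ge0 HN x) xM.
pose c := d * (2 * M + 3).
have c0 : 0 < c by rewrite mulr_gt0//; lra.
pose f (y : 'M[S]_n) : 'M[S]_n := y - (y + y - 1) * (y *m y - y).
pose u k := iter k f x.
(* Expanding the product keeps the norm of the identity matrix, which can grow with [n], out of the
   estimates. This is where the factor [2 (M + 1) + 1 = 2 M + 3] of [c] comes from. *)
have fE y : f y = y - (y *m (y *m y - y) + y *m (y *m y - y) - (y *m y - y)).
  by rewrite /f mulrBl mul1r mulrDl.
have step k : D (u k) <= M + 1 -> D (u k *m u k - u k) <= d / 2 ^+ k ->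
    D (u k.+1 - u k) <= c / 2 ^+ k.
  move=> uM ud; rewrite /= -/(u k) fE addrAC subrr add0r mxnormN//.
  move: (u k *m u k - u k) ud => e ud.
  apply: (le_trans (mxnormB HN _ _)).
  apply: (le_trans (lerD (mxnormD HN _ _) (lexx _))).
  rewrite /c; have := mxnormM_le HN uM ud; nra.
have inv k : [/\ mxstar (u k) = u k, D (u k) <= M + 2 * c - 2 * c / 2 ^+ k &
    D (u k *m u k - u k) <= d / 2 ^+ k].
  elim: k => [|k [us uM ud]]; first by rewrite expr0 !divr1 addrK.
  have k0 : 0 <= 2 * c / 2 ^+ k.
    by rewrite divr_ge0 ?exprn_ge0// mulr_ge0// ltW.
  have uM1 : D (u k) <= M + 1 by move: dM; rewrite -/c; lra.
  have uc := step k uM1 ud; split.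
  - rewrite /= -/(u k) fE !(mxstarN, mxstarD, mxstarM) us.
    by rewrite mulmxBr mulmxBl !mulmxA.
  - have := mxnormD HN (u k) (u k.+1 - u k); rewrite addrC subrK geom2S.
    have -> : 2 * c / 2 ^+ k = c / 2 ^+ k * 2 by rewrite mulrAC mulrC mulrA mulrAC.
    by move: uc uM; rewrite -[2 * c / _]mulrA; lra.
  have := newton_idempotent (u k); rewrite /= -/(u k) -/(f (u k)).
  rewrite -!mulmxE => ->.
  move: (u k *m u k - u k) ud => e ud; rewrite geom2S.
  have d8k : d / 2 ^+ k <= 8^-1.
    rewrite ler_pdivrMr ?exprn_gt0//; apply: (le_trans d8).
    by rewrite ler_peMr ?invr_ge0// exprn_ege1// ler1n.
  have e8 := le_trans ud d8k; have e0 := mxnorm_ge0 HN e.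
  have ee := mxnormM HN e e; have eee := mxnormM HN (e *m e) e.
  have le4 (y : 'M[S]_n) : D (y *+ 4) <= 4 * D y.
    have y2 := mxnormD HN y y; have := mxnormD HN (y + y) (y + y).
    by rewrite -!mulr2n -mulrnA; lra.
  have le3 (y : 'M[S]_n) : D (y *+ 3) <= 3 * D y.
    have y2 := mxnormD HN y y; have := mxnormD HN (y + y) y.
    by rewrite -mulr2n -mulrSr; lra.
  apply: (le_trans (mxnormB HN _ _)).
  have := le4 (e *m e *m e); have := le3 (e *m e).
  have ee0 := mxnorm_ge0 HN (e *m e).
  move: (D (e *m e *m e *+ 4)) (D (e *m e *+ 3)) => a b.
  move: (D (e *m e *m e)) (D (e *m e)) (D e) ee eee e0 e8 ud ee0 => r s t.
  move: (d / 2 ^+ k) => w; clear => ? ? ? ? ? ? ? ?.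
  have : s * t <= s / 8 by nra.
  have : t * t <= t / 8 by nra.
  by lra.
have k0 k : 0 <= 2 * c / 2 ^+ k.
  by rewrite divr_ge0 ?exprn_ge0// mulr_ge0// ltW.
have uM k : D (u k) <= M + 1.
  by have [_ + _] := inv k; have := k0 k; move: dM; rewrite -/c; lra.
have uc k : D (u k.+1 - u k) <= c / 2 ^+ k.
  by apply: step => //; have [] := inv k.
have [p up] := mx_geom_limit HN c0 uc.
exists p; split; last by have := up 0%N; rewrite expr0 divr1.
  apply/eqP; rewrite -subr_eq0; apply/eqP/(mxnorm_eq0 HN).
  apply: (@le0_geom2 _ (2 * c * (D p + (M + 1) + 1) + d)); first exact: mxnorm_ge0.
  move=> k; have [_ _ ud] := inv k.
  (* The defect of the limit is compared with that of [u k]; each summand is at most a constant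
     times [2^-k]. *)
  have -> : p *m p - p = (p - u k) *m p + u k *m (p - u k)
      + (u k *m u k - u k) + (u k - p).
    rewrite mulmxBl mulmxBr !addrA.
    rewrite [RHS](ACl ((1*8)*(2*3)*(4*5)*(6*7)))/=.
    by rewrite addNr !addr0 addNr addr0 addNr addr0.
  have pu : D (p - u k) <= 2 * c / 2 ^+ k by rewrite mxnormBC.
  have h1 := mxnormM_le HN pu (lexx (D p)).
  have h2 := mxnormM_le HN (uM k) pu.
  have h3 := le_trans (mxnormD HN _ _) (lerD h1 h2).
  have h4 := le_trans (mxnormD HN _ _) (lerD h3 ud).
  apply: (le_trans (mxnormD HN _ _)); apply: (le_trans (lerD h4 (up k))).
  by rewrite le_eqVlt; apply/orP; left; apply/eqP; ring.
apply: (mxnormB_eq0 HN); apply: (@le0_geom2 _ (4 * c)); first exact: mxnorm_ge0.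
move=> k; have [us _ _] := inv k.
apply: (le_trans (mxnormB_trans HN (u k) _ _)).
have -> : D (mxstar p - u k) = D (u k - p).
  by rewrite -(mxnorm_star HN) mxstarB mxstarK us mxnormBC.
by have := up k; move: (2 ^+ k)^-1 => w; lra.
Qed.
End Newton.

(** * Approximate equivalences of projections become exact *)

Section PartialIsometry.
Variables (R : realType) (S : starAlg R[i]) (N : S -> R).
Hypothesis HN : banach_star_norm N.
Implicit Types m n : nat.
Local Notation D := (mxnorm N).

(* One step of [y |-> y (3 - y^* y) / 2], whose fixed points are partial
   isometries: the defect [p - y^* y] is squared. *)
Lemma newton_schulz m n (p : 'M[S]_m) (w : 'M[S]_(n, m)) :
  p *m p = p -> mxstar p = p -> w *m p = w ->
  let h := p - mxstar w *m w in let y := w + mxhalf (w *m h) in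
  p - mxstar y *m y = h *m h - mxhalf (mxhalf (h *m h - h *m h *m h)).
Proof.
move=> pp ps wp; have pw : p *m mxstar w = mxstar w.
  by rewrite -{1}ps -mxstarM wp.
have [g gE] : exists g, g = mxstar w *m w by eexists.
rewrite /= -gE; have [h hE] : exists h, h = p - g by eexists.
have pg : p *m g = g by rewrite gE mulmxA pw.
have gp : g *m p = g by rewrite gE -mulmxA wp.
have gs : mxstar g = g by rewrite gE mxstarM mxstarK.
have hs : mxstar h = h by rewrite hE mxstarB ps gs.
have ph : p *m h = h by rewrite hE mulmxBr pp pg.
have gh : g *m h = h - h *m h.
  by rewrite -[g](subKr p) -hE mulmxBl ph.
have hp : h *m p = h by rewrite hE mulmxBl pp gp.
have hg : h *m g = h - h *m h.
  by rewrite -[g](subKr p) -hE mulmxBr hp.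
rewrite -hE mxstarD mxhalf_star mxstarM hs mulmxDl !mulmxDr mxhalfMr !mxhalfMl.
rewrite mxhalfMr !mulmxA -(mulmxA h (mxstar w) w) -gE gh hg mulmxBl.
rewrite addrA -[g + _ + _]addrA mxhalf2 -{1}[g](subKr p) -hE.
by rewrite addrA subrK opprD addrA subKr.
Qed.

Lemma projection_small_eq0 n (f : 'M[S]_n) : f *m f = f -> D f < 1 -> f = 0.
Proof.
move=> ff f1; apply: (mxnorm_eq0 HN).
have := mxnormM HN f f; rewrite ff; have := mxnorm_ge0 HN f; nra.
Qed.

(** The iteration of [newton_schulz] preserves [y p = y] and [q y = y], and its limit [v] satisfies
    [v^* v = p]. Then [q - v v^*] is idempotent; as [v] lies within [2 c] of [w], its norm is below
    1, so it vanishes. *)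
Lemma partial_isometry_near m n (p : 'M[S]_m) (q : 'M[S]_n) (w : 'M[S]_(n, m))
    (M d : R) :
  p *m p = p -> mxstar p = p -> q *m q = q -> mxstar q = q ->
  w *m p = w -> q *m w = w -> D w <= M ->
  D (p - mxstar w *m w) <= d -> D (q - w *m mxstar w) <= d ->
  0 < d -> d * (8 * (M + 1) ^+ 2) <= 1 ->
  exists v : 'M[S]_(n, m), mxstar v *m v = p /\ v *m mxstar v = q.
Proof.
move=> pp ps qq qs wp qw wM wd wd' d0 dM.
have M0 : 0 <= M := le_trans (mxnorm_ge0 HN w) wM.
pose c := (M + 1) * d.
have c0 : 0 < c by rewrite mulr_gt0// ltr_wpDl.
have M1 : 1 <= (M + 1) ^+ 2 by rewrite exprn_ege1// lerDr.
have d8 : d <= 8^-1 by nra.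
have cM : 2 * c <= 4^-1.
  have : M + 1 <= (M + 1) ^+ 2 by rewrite ler_eXnr ?lerDr.
  by rewrite /c; nra.
pose h (y : 'M[S]_(n, m)) := p - mxstar y *m y.
pose f (y : 'M[S]_(n, m)) := y + mxhalf (y *m h y).
pose u k := iter k f w.
have step k : D (u k) <= M + 1 -> D (h (u k)) <= d / 2 ^+ k ->
    D (u k.+1 - u k) <= c / 2 ^+ k.
  move=> uM ud; rewrite /= -/(u k) /f addrAC subrr add0r mxnorm_half//.
  have := mxnormM_le HN uM ud; rewrite mulrA -/c.
  by have := mxnorm_ge0 HN (u k *m h (u k)); lra.
have inv k : [/\ u k *m p = u k, q *m u k = u k,
    D (u k) <= M + 2 * c - 2 * c / 2 ^+ k & D (h (u k)) <= d / 2 ^+ k].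
  elim: k => [|k [up qu uM ud]]; first by rewrite expr0 !divr1 addrK.
  have k0 : 0 <= 2 * c / 2 ^+ k.
    by rewrite divr_ge0 ?exprn_ge0// mulr_ge0// ltW.
  have uM1 : D (u k) <= M + 1 by move: cM; lra.
  have uc := step k uM1 ud; split.
  - rewrite /= -/(u k) /f mulmxDl up mxhalfMl -mulmxA mulmxBl pp.
    by rewrite -mulmxA up.
  - by rewrite /= -/(u k) /f mulmxDr mxhalfMr mulmxA qu.
  - have := mxnormD HN (u k) (u k.+1 - u k); rewrite addrC subrK geom2S.
    have -> : 2 * c / 2 ^+ k = c / 2 ^+ k * 2 by rewrite mulrAC mulrC mulrA mulrAC.
    by move: uc uM; rewrite -[2 * c / _]mulrA; lra.
  rewrite /= -/(u k) /h /f newton_schulz// -/(h (u k)).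
  move: (h (u k)) ud => e ud; rewrite geom2S.
  have d8k : d / 2 ^+ k <= 8^-1.
    rewrite ler_pdivrMr ?exprn_gt0//; apply: (le_trans d8).
    by rewrite ler_peMr ?invr_ge0// exprn_ege1// ler1n.
  have e8 := le_trans ud d8k; have e0 := mxnorm_ge0 HN e.
  have ee := mxnormM HN e e; have eee := mxnormM HN (e *m e) e.
  apply: (le_trans (mxnormB HN _ _)); rewrite !mxnorm_half//.
  have := mxnormB HN (e *m e) (e *m e *m e).
  have ee0 := mxnorm_ge0 HN (e *m e).
  move: (D (e *m e - e *m e *m e)) => a.
  move: (D (e *m e *m e)) (D (e *m e)) (D e) ee eee e0 e8 ud ee0 => r s t.
  move: (d / 2 ^+ k) => z; clear => ? ? ? ? ? ? ?.
  have : s * t <= s / 8 by nra.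
  have : t * t <= t / 8 by nra.
  by lra.
have k0 k : 0 <= 2 * c / 2 ^+ k.
  by rewrite divr_ge0 ?exprn_ge0// mulr_ge0// ltW.
have uM k : D (u k) <= M + 1.
  by have [_ _ + _] := inv k; have := k0 k; move: cM; lra.
have uc k : D (u k.+1 - u k) <= c / 2 ^+ k.
  by apply: step => //; have [] := inv k.
have [v uv] := mx_geom_limit HN c0 uc.
have vM : D v <= M + 1.
  have := mxnormB HN w (w - v); rewrite subKr; have := uv 0%N.
  by rewrite expr0 divr1 /=; move: cM; lra.
have qv : q *m v = v.
  apply: (mxnormB_eq0 HN).
  apply: (@le0_geom2 _ ((D q + 1) * (2 * c))); first exact: mxnorm_ge0.
  move=> k; have [_ qu _ _] := inv k.
  have -> : q *m v - v = (u k - v) - q *m (u k - v).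
    by rewrite mulmxBr qu opprB [RHS]addrC subrKA.
  apply: (le_trans (mxnormB HN _ _)).
  have := mxnormM_le HN (lexx (D q)) (uv k); have := uv k.
  by rewrite -mulrA mulrDl mul1r; lra.
have vp : v *m p = v.
  apply: (mxnormB_eq0 HN).
  apply: (@le0_geom2 _ ((2 * c) * (D p + 1))); first exact: mxnorm_ge0.
  move=> k; have [up _ _ _] := inv k.
  have -> : v *m p - v = (u k - v) - (u k - v) *m p.
    by rewrite mulmxBl up opprB [RHS]addrC subrKA.
  apply: (le_trans (mxnormB HN _ _)).
  have := mxnormM_le HN (uv k) (lexx (D p)); have := uv k.
  by rewrite mulrDr mulr1 mulrDl [_ * D p / _]mulrAC; lra.
have vv : mxstar v *m v = p.
  apply/esym/(mxnormB_eq0 HN).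
  apply: (@le0_geom2 _ (d + (M + 1) * (2 * c) * 2)); first exact: mxnorm_ge0.
  move=> k; have [_ _ _ ud] := inv k.
  have -> : p - mxstar v *m v =
      h (u k) + (mxstar (u k) *m (u k - v) + mxstar (u k - v) *m v).
    by rewrite mulmxBr mxstarB mulmxBl !addrA !subrK.
  have uvk := uv k; have usk : D (mxstar (u k - v)) <= 2 * c / 2 ^+ k.
    by rewrite mxnorm_star.
  have h1 := mxnormM_le HN (_ : D (mxstar (u k)) <= M + 1) uvk.
  have h2 := mxnormM_le HN usk vM.
  apply: (le_trans (mxnormD HN _ _)); apply: (le_trans (lerD ud (mxnormD HN _ _))).
  apply: (le_trans (lerD (lexx _) (lerD (h1 _) h2))); first by rewrite mxnorm_star.
  by rewrite le_eqVlt; apply/orP; left; apply/eqP; ring.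
exists v; split => //; apply/eqP; rewrite eq_sym -subr_eq0; apply/eqP.
have vq : mxstar v *m q = mxstar v by rewrite -{1}qs -mxstarM qv.
have pv : p *m mxstar v = mxstar v by rewrite -{1}ps -mxstarM vp.
apply: projection_small_eq0.
  rewrite mulmxBl !mulmxBr qq mulmxA qv -(mulmxA v (mxstar v) q) vq.
  by rewrite -[v *m mxstar v *m _]mulmxA (mulmxA (mxstar v)) vv pv subrr subr0.
have -> : q - v *m mxstar v = (q - w *m mxstar w)
    + ((w - v) *m mxstar w + v *m mxstar (w - v)).
  by rewrite mulmxBl mxstarB mulmxBr !addrA !subrK.
have wv : D (w - v) <= 2 * c by have := uv 0%N; rewrite expr0 divr1.
have wsM : D (mxstar w) <= M + 1 by rewrite mxnorm_star// (le_trans wM)// lerDl.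
have wvs : D (mxstar (w - v)) <= 2 * c by rewrite mxnorm_star.
have h1 := mxnormM_le HN wv wsM; have h2 := mxnormM_le HN vM wvs.
apply: (le_lt_trans (mxnormD HN _ _)).
apply: (le_lt_trans (lerD wd' (le_trans (mxnormD HN _ _) (lerD h1 h2)))).
rewrite /c; move: dM M1; rewrite expr2; nra.
Qed.

(** Chosen so that [d = (M^3 (1 + 2 M) + 1) * mvn_tol M] satisfies [8 d (M^3 + 1)^2 = 1], as
    [partial_isometry_near] requires for [q v p], whose norm is at most [M^3]. The factor
    [M^3 (1 + 2 M)] is the loss in [compress_near]; the added 1 ensures positivity. *)
Definition mvn_tol (M : R) : R :=
  ((8 * (M ^+ 3 + 1) ^+ 2) * (M ^+ 3 * (1 + 2 * M) + 1))^-1.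

Lemma mvn_tol_gt0 M : 0 <= M -> 0 < mvn_tol M.
Proof.
move=> M0; have M3 : 0 <= M ^+ 3 by rewrite exprn_ge0.
rewrite invr_gt0 mulr_gt0//; first by rewrite mulr_gt0// exprn_gt0//; lra.
by nra.
Qed.

(** Cutting [v] down to [q v p] gains the exact support conditions. Between two factors [p], the new
    defect consists of an error from [v v^* - q] and one from [a^2 - p] with [a = v^* v]; the latter
    splits as [(a - p) p + a (a - p)]. *)
Lemma compress_near m n (p : 'M[S]_m) (q : 'M[S]_n) (v : 'M[S]_(n, m)) (M d : R) :
  p *m p = p -> mxstar p = p -> mxstar q = q -> q *m q = q ->
  D p <= M -> D v <= M ->
  D (mxstar v *m v - p) <= d -> D (v *m mxstar v - q) <= d ->
  D (p - mxstar (q *m v *m p) *m (q *m v *m p)) <= M ^+ 3 * (1 + 2 * M) * d.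
Proof.
move=> pp ps qs qq pM vM vd vd'.
have vsM : D (mxstar v) <= M by rewrite mxnorm_star.
have M0 : 0 <= M := le_trans (mxnorm_ge0 HN p) pM.
have d0 : 0 <= d := le_trans (mxnorm_ge0 HN _) vd.
have -> : p - mxstar (q *m v *m p) *m (q *m v *m p) =
    p *m (mxstar v *m (v *m mxstar v - q) *m v
          - ((mxstar v *m v - p) *m p + mxstar v *m v *m (mxstar v *m v - p))) *m p.
  rewrite !mxstarM ps qs.
  have -> : p *m (mxstar v *m q) *m (q *m v *m p) = p *m (mxstar v *m q *m v) *m p.
    by rewrite !mulmxA -(mulmxA _ q q) qq.
  have ppp : p = p *m p *m p by rewrite !pp.
  rewrite {1}ppp -mulmxBl -mulmxBr; congr (_ *m _ *m _).
  rewrite mulmxBr !mulmxBl mulmxBr pp !mulmxA.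
  move: (mxstar v *m v *m mxstar v *m v) (mxstar v *m q *m v) (mxstar v *m v *m p).
  move=> a b e; rewrite opprD !opprB !addrA [RHS](ACl (3*2*(1*6)*(5*4)))/=.
  by rewrite !subrr !addr0.
have h1 := mxnormM_le HN (mxnormM_le HN vsM vd') vM.
have h2 := mxnormM_le HN vd pM.
have h3 := mxnormM_le HN (mxnormM_le HN vsM vM) vd.
have h4 := le_trans (mxnormB HN _ _) (lerD h1 (le_trans (mxnormD HN _ _) (lerD h2 h3))).
apply: (le_trans (mxnormM_le HN (mxnormM_le HN pM h4) pM)).
by rewrite le_eqVlt; apply/orP; left; apply/eqP; ring.
Qed.

(** The tolerance depends only on a common norm bound, not on the sizes or the algebra, so one
    threshold serves all quotients of [A] at once. *)
Lemma mvn_near m n (p : 'M[S]_m) (q : 'M[S]_n) (v : 'M[S]_(n, m)) (M : R) :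
  p *m p = p -> mxstar p = p -> q *m q = q -> mxstar q = q ->
  D p <= M -> D q <= M -> D v <= M ->
  D (mxstar v *m v - p) <= mvn_tol M -> D (v *m mxstar v - q) <= mvn_tol M ->
  exists u : 'M[S]_(n, m), mxstar u *m u = p /\ u *m mxstar u = q.
Proof.
move=> pp ps qq qs pM qM vM vp vq.
have M0 : 0 <= M := le_trans (mxnorm_ge0 HN p) pM.
have t0 := mvn_tol_gt0 M0.
pose d := (M ^+ 3 * (1 + 2 * M) + 1) * mvn_tol M.
have M3 : 0 <= M ^+ 3 by rewrite exprn_ge0.
have B0 : 0 <= M ^+ 3 * (1 + 2 * M) by rewrite mulr_ge0//; lra.
have d0 : 0 < d by rewrite mulr_gt0// ltr_wpDl.
have Bd : M ^+ 3 * (1 + 2 * M) * mvn_tol M <= d.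
  by rewrite /d [leRHS]mulrDl mul1r lerDl ltW.
apply: (@partial_isometry_near _ _ p q (q *m v *m p) (M ^+ 3) d) => //.
- by rewrite -mulmxA pp.
- by rewrite !mulmxA qq.
- by rewrite exprSr expr2; apply: mxnormM_le => //; apply: mxnormM_le.
- by apply: le_trans Bd; apply: compress_near.
- apply: le_trans Bd.
  (* The second defect is the first one for the adjoint of [v], with [p] and [q] exchanged. *)
  have -> : q *m v *m p *m mxstar (q *m v *m p) =
      mxstar (p *m mxstar v *m q) *m (p *m mxstar v *m q).
    by rewrite !mxstarM mxstarK ps qs !mulmxA.
  apply: compress_near => //; first by rewrite mxnorm_star.
    by rewrite mxstarK.
  by rewrite mxstarK.
rewrite /d /mvn_tol mulrAC [X in X / _]mulrC divff// mulf_neq0// gt_eqF//.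
  by rewrite mulr_gt0// exprn_gt0// ltr_wpDl.
by rewrite ltr_wpDl.
Qed.
End PartialIsometry.

(** * The distance to an ideal as a submultiplicative seminorm *)

Section DistanceToIdeal.
Variables (R : realType) (A : cstarAlg R).
Implicit Types (K : closed_ideal A) (x y : A) (r : R).

Let dist_has_inf x K : has_inf [set rnorm (x - y) | y in ideal_set K].
Proof.
split; first by exists (rnorm (x - 0)), 0 => //; exact: ideal0.
by exists 0 => _ [y _ <-]; exact: rnorm_ge0.
Qed.

Lemma dist_to_le K x y : ideal_set K y -> dist_to x K <= rnorm (x - y).
Proof. by move=> Ky; apply: ge_inf; [have [] := dist_has_inf x K | exists y]. Qed.

Lemma dist_to_ge0 K x : 0 <= dist_to x K.
Proof.
apply: lb_le_inf; first by have [] := dist_has_inf x K.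
by move=> _ [y _ <-]; exact: rnorm_ge0.
Qed.

Lemma dist_to_lt K x r : dist_to x K < r ->
  exists2 y, ideal_set K y & rnorm (x - y) < r.
Proof.
move=> xr; have e0 : 0 < r - dist_to x K by rewrite subr_gt0.
have [_ [y Ky <-] yr] := inf_adherent e0 (dist_has_inf x K).
by exists y => //; move: yr; rewrite -/(dist_to x K) [ltRHS]addrC subrK.
Qed.

Lemma dist_to_rnorm K x : dist_to x K <= rnorm x.
Proof. by have := dist_to_le x (ideal0 K); rewrite subr0. Qed.

Lemma dist_toD K x y : dist_to (x + y) K <= dist_to x K + dist_to y K.
Proof.
apply/ler_addgt0Pr => e e0; have e2 : 0 < e / 2 by rewrite divr_gt0.
have [u Ku xu] := dist_to_lt (ltr_pwDr e2 (lexx (dist_to x K))).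
have [v Kv yv] := dist_to_lt (ltr_pwDr e2 (lexx (dist_to y K))).
apply: (le_trans (dist_to_le _ (idealD Ku Kv))).
have := rnormD (x - u) (y - v); rewrite addrACA -opprD; lra.
Qed.

Lemma dist_to_star_le K x : dist_to (cstar x) K <= dist_to x K.
Proof.
apply/ler_addgt0Pr => e e0.
have [u Ku xu] := dist_to_lt (ltr_pwDr e0 (lexx (dist_to x K))).
apply: (le_trans (dist_to_le _ (ideal_star Ku))).
by rewrite -cstarN -cstarD rnorm_star ltW.
Qed.

Lemma dist_to_star K x : dist_to (cstar x) K = dist_to x K.
Proof.
by apply/eqP; rewrite eq_le dist_to_star_le -{1}[x]cstarK dist_to_star_le.
Qed.

Lemma dist_toZ_le K (c : R) x : 0 <= c -> dist_to (c%:C *: x) K <= c * dist_to x K.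
Proof.
move=> c0; apply/ler_addgt0Pr => e e0.
have e1 : 0 < e / (c + 1) by rewrite divr_gt0// ltr_wpDl.
have [u Ku xu] := dist_to_lt (ltr_pwDr e1 (lexx (dist_to x K))).
apply: (le_trans (dist_to_le _ (idealZ c%:C Ku))).
rewrite -scalerBr rnormZ//; apply: (le_trans (ler_wpM2l c0 (ltW xu))).
rewrite mulrDr lerD2l mulrA ler_pdivrMr ?ltr_wpDl//; nra.
Qed.

Lemma dist_toZ K (c : R) x : 0 < c -> dist_to (c%:C *: x) K = c * dist_to x K.
Proof.
move=> c0; apply/eqP; rewrite eq_le (dist_toZ_le _ _ (ltW c0))/=.
have ci : 0 <= c^-1 by rewrite invr_ge0 ltW.
have := dist_toZ_le K (c%:C *: x) ci; rewrite scalerA -rmorphM/= mulVf ?gt_eqF//.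
by rewrite scale1r ler_pdivlMl.
Qed.

Lemma dist_toN K x : dist_to (- x) K = dist_to x K.
Proof.
have le z : dist_to (- z) K <= dist_to z K.
  apply/ler_addgt0Pr => e e0.
  have [u Ku xu] := dist_to_lt (ltr_pwDr e0 (lexx (dist_to z K))).
  by rewrite (le_trans (dist_to_le _ (idealN Ku)))// -opprD rnormN ltW.
by apply/eqP; rewrite eq_le le -{1}[x]opprK le.
Qed.

Lemma dist_toM K x y : dist_to (x * y) K <= dist_to x K * dist_to y K.
Proof.
set a := dist_to x K; set b := dist_to y K.
have a0 : 0 <= a := dist_to_ge0 K x.
have b0 : 0 <= b := dist_to_ge0 K y.
apply/ler_addgt0Pr => e e0.
(* Since [t <= 1], [(a + t) (b + t) <= a b + t (a + b + 1) <= a b + e]. *)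
pose t := Num.min 1 (e / (a + b + 1)).
have ab : 0 < a + b + 1 by rewrite ltr_wpDl// addr_ge0.
have t0 : 0 < t by rewrite lt_min ltr01 divr_gt0.
have t1 : t <= 1 by rewrite ge_min lexx.
have te : t * (a + b + 1) <= e.
  by rewrite -ler_pdivlMr// ge_min lexx orbT.
have [u Ku xu] := dist_to_lt (ltr_pwDr t0 (lexx a)).
have [v Kv yv] := dist_to_lt (ltr_pwDr t0 (lexx b)).
(* This element of [K] is chosen so that its difference from [x y] factors as [(x - u) (y - v)]. *)
have Kw : ideal_set K (u * y + (x - u) * v).
  by apply: idealD; [apply: ideal_mulr | apply: ideal_mull].
apply: (le_trans (dist_to_le _ Kw)).
have -> : x * y - (u * y + (x - u) * v) = (x - u) * (y - v).
  by rewrite opprD addrA -mulrBl -mulrBr.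
apply: (le_trans (rnormM _ _)).
apply: (@le_trans _ _ ((a + t) * (b + t))).
  by rewrite ler_pM ?rnorm_ge0 ?ltW.
by move: te; nra.
Qed.

Lemma dist_to_eq0 K x : dist_to x K = 0 -> ideal_set K x.
Proof.
by move=> x0; apply: ideal_approx => e e0; apply: dist_to_lt; rewrite x0.
Qed.

Lemma dist_to_ideal K x : ideal_set K x -> dist_to x K = 0.
Proof.
move=> Kx; apply/eqP; rewrite eq_le dist_to_ge0 andbT.
by have := dist_to_le x Kx; rewrite subrr /rnorm normr0.
Qed.

Lemma dist_to_lip K x y : dist_to x K <= rnorm (x - y) + dist_to y K.
Proof.
by rewrite -{1}[x](subrK y) (le_trans (dist_toD _ _ _))// lerD2r dist_to_rnorm.
Qed.

Lemma dist_to_mod K x y : ideal_set K (x - y) -> dist_to x K = dist_to y K.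
Proof.
have le u v : ideal_set K (u - v) -> dist_to u K <= dist_to v K.
  move=> Kuv; rewrite -{1}[u](subrK v) (le_trans (dist_toD _ _ _))//.
  by rewrite dist_to_ideal// add0r.
move=> Kxy; apply/eqP; rewrite eq_le !le//.
by rewrite -opprB; apply: idealN.
Qed.

Lemma cstar_geom_limit (u : nat -> A) (c : R) : 0 < c ->
  (forall k, rnorm (u k.+1 - u k) <= c / 2 ^+ k) ->
  exists l, forall k, rnorm (u k - l) <= 2 * c / 2 ^+ k.
Proof.
move=> c0 uc.
have n0 : rnorm (0 : A) = 0 by rewrite /rnorm normr0.
have uj := geom2_cauchy n0 (@rnormN R A) (@rnormD R A) (ltW c0) uc.
have /cauchy_cvg ul : cauchy (u @ \oo).
  apply: cauchy_exP => e e0.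
  have er : (complex.Re e)%:C = e by rewrite RRe_real// gtr0_real.
  have e0r : 0 < complex.Re e by rewrite -ltcR er.
  have [k kc] := ltr_geom2 (2 * c) e0r.
  exists (u k), k => // i /= ki.
  rewrite -ball_normE /ball_ /= rnormE -er ltcR (le_lt_trans _ kc)//.
  by rewrite -(subnKC ki) uj.
exists (lim (u @ \oo)) => k; apply/ler_addgt0Pr => e e0.
have /cvgrPdist_lt/(_ e%:C) := ul; rewrite ltcR => /(_ e0)[i _ iP].
have := iP (k + i)%N (leq_addl _ _); rewrite /= rnormE ltcR => le.
have := rnormD (u k - u (k + i)%N) (u (k + i)%N - lim (u @ \oo)).
rewrite subrKA => /le_trans; apply; apply: lerD => //.
by rewrite -rnormN opprB ltW.
Qed.
End DistanceToIdeal.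

(** * The quotient norm, and lifting from the quotient to the algebra *)

Section QuotientNorm.
Variables (R : realType) (A : cstarAlg R) (K : closed_ideal A).
Local Notation S := (quotient_algebra K).

Definition qpi (x : starAlg_of A) : S := quot_pi K x.
Definition qnorm (a : S) : R := dist_to (quot_repr a) K.

Lemma qpi_is_zmod_morphism : zmod_morphism qpi.
Proof.
move=> x y; apply: (addIr (qpi y)); rewrite subrK -[LHS]quot_piD.
by congr quot_pi; apply: subrK.
Qed.

Lemma qpi_is_monoid_morphism : monoid_morphism qpi.
Proof. by split => // x y; exact: quot_piM. Qed.

HB.instance Definition _ :=
  GRing.isZmodMorphism.Build (starAlg_of A) S qpi qpi_is_zmod_morphism.
HB.instance Definition _ :=
  GRing.isMonoidMorphism.Build (starAlg_of A) S qpi qpi_is_monoid_morphism.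

Lemma qpi_star x : qpi (star x) = star (qpi x).
Proof. exact: quot_pi_star. Qed.

Lemma qpiZ (c : R[i]) x : qpi (c *: x) = c *: qpi x.
Proof. exact: quot_piZE. Qed.

Lemma qpi_surj (a : S) : exists x, qpi x = a.
Proof. by exists (quot_repr a); exact: quot_reprK. Qed.

Lemma qnorm_qpi x : qnorm (qpi x) = dist_to x K.
Proof. exact/dist_to_mod/quot_reprP. Qed.

(** For completeness, lift the sequence and correct each increment by an element of [K] so that it
    is almost as short as its class; the corrected lifts converge in [A]. The approximation and the
    limit each cost a factor 2, hence the 4 in [bnorm_complete]. *)
Lemma qnorm_banach : banach_star_norm qnorm.
Proof.
have el (P : S -> Prop) : (forall x, P (qpi x)) -> forall a, P a.
  by move=> Px a; have [x <-] := qpi_surj a.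
split.
- elim/el => x; rewrite qnorm_qpi => /dist_to_eq0 Kx.
  by rewrite -(rmorph0 qpi); apply/quot_piP; rewrite subr0.
- by rewrite -(rmorph0 qpi) qnorm_qpi; apply/dist_to_ideal/ideal0.
- by elim/el => x; rewrite -rmorphN !qnorm_qpi; exact: dist_toN.
- elim/el => x; elim/el => y; rewrite -rmorphD !qnorm_qpi; exact: dist_toD.
- elim/el => x; elim/el => y; rewrite -rmorphM !qnorm_qpi; exact: dist_toM.
- by elim/el => x; rewrite -qpi_star !qnorm_qpi; exact: dist_to_star.
- elim/el => x; rewrite -qpiZ !qnorm_qpi mulrC; apply: dist_toZ.
  by rewrite invr_gt0.
move=> u c c0 uc.
have [U UE] := choice (fun k => qpi_surj (u k)).
have ex k : exists z, ideal_set K z /\ rnorm ((U k.+1 : A) - U k - z) <= 2 * c / 2 ^+ k.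
  have : dist_to ((U k.+1 : A) - U k) K < 2 * c / 2 ^+ k.
    apply: le_lt_trans (_ : c / 2 ^+ k < _).
      have := uc k; rewrite -!UE -rmorphB qnorm_qpi; exact.
    by rewrite ltr_pM2r ?invr_gt0 ?exprn_gt0//; lra.
  by move=> /dist_to_lt[z Kz zlt]; exists z; split => //; exact: ltW.
have [z zP] := choice ex.
pose W k : A := (U k : A) - \sum_(j < k) z j.
have c20 : 0 < 2 * c by rewrite mulr_gt0.
have [k|l Wl] := @cstar_geom_limit _ A W (2 * c) c20.
  have [_] := zP k; rewrite /W big_ord_recr/= opprB opprD.
  congr (rnorm _ <= _); rewrite !addrA [RHS](ACl (1*5*3*(2*4)))/=.
  by rewrite addNr addr0.
exists (qpi l) => k; rewrite -(UE k) -rmorphB qnorm_qpi.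
have -> : dist_to ((U k : starAlg_of A) - l) K = dist_to (W k - l) K.
  apply: dist_to_mod.
  have UW : (U k : A) - l - (W k - l) = \sum_(j < k) z j.
    by rewrite opprB subrKA /W opprB addrC subrK.
  rewrite [X in ideal_set K X](UW : _ = _).
  by apply: ideal_sum => j; have [] := zP j.
apply: (le_trans (dist_to_rnorm _ _)); apply: (le_trans (Wl k)).
by rewrite mulrA -natrM.
Qed.

Local Notation pi M := (map_mx qpi M).

Lemma mxnorm_qpi m n (M : 'M[starAlg_of A]_(m, n)) :
  mxnorm qnorm (pi M) = mxnorm (fun x => dist_to x K) M.
Proof. by do 2 (apply: eq_bigr => ? _); rewrite mxE qnorm_qpi. Qed.

Lemma mxnorm_qpi_le m n (M : 'M[starAlg_of A]_(m, n)) :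
  mxnorm qnorm (pi M) <= mxnorm (@rnorm R A) M.
Proof. by rewrite mxnorm_qpi; do 2 (apply: ler_sum => ? _); exact: dist_to_rnorm. Qed.

Lemma mxstar_qpi m n (M : 'M[starAlg_of A]_(m, n)) : mxstar (pi M) = pi (mxstar M).
Proof. by apply/matrixP => i j; rewrite !mxE qpi_star. Qed.

Lemma mxhalf_qpi m n (M : 'M[starAlg_of A]_(m, n)) : mxhalf (pi M) = pi (mxhalf M).
Proof. by apply/matrixP => i j; rewrite !mxE qpiZ. Qed.

Lemma mx_qpi_surj m n (M : 'M[S]_(m, n)) :
  exists M' : 'M[starAlg_of A]_(m, n), pi M' = M.
Proof.
have ex (ij : 'I_m * 'I_n) := qpi_surj (M ij.1 ij.2).
have [f fP] := choice ex; exists (\matrix_(i, j) f (i, j)).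
by apply/matrixP => i j; rewrite !mxE fP.
Qed.

(** Averaging a lift with its adjoint does not change the class, as [p] is self-adjoint. *)
Lemma mx_qpi_lift_selfadj n (p : 'M[S]_n) : mxstar p = p ->
  exists2 P : 'M[starAlg_of A]_n, mxstar P = P & pi P = p.
Proof.
move=> ps; have [P PE] := mx_qpi_surj p; exists (mxhalf (P + mxstar P)).
  by rewrite mxhalf_star mxstarD mxstarK addrC.
by rewrite -mxhalf_qpi map_mxD -mxstar_qpi PE ps mxhalfD mxhalf2.
Qed.
End QuotientNorm.

(** * Conditions stable under small perturbations of the ideal *)

Section NearIdeal.
Variables (R : realType) (A : cstarAlg R).
Implicit Types (K : closed_ideal A) (P Q : closed_ideal A -> Prop).

(* P holds on a neighbourhood of K for the topology generated by the upper
   conditions d(x, K) < r only. *)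
Definition upper_near K P := exists s : seq (A * R),
  (forall xr, xr \in s -> dist_to xr.1 K < xr.2) /\
  forall K', (forall xr, xr \in s -> dist_to xr.1 K' < xr.2) -> P K'.

Lemma upper_near_and K P Q : upper_near K P -> upper_near K Q ->
  upper_near K (fun K' => P K' /\ Q K').
Proof.
move=> [s [sK sP]] [t [tK tQ]]; exists (s ++ t); split.
  by move=> xr; rewrite mem_cat => /orP[/sK|/tK].
move=> K' K'P; split; [apply: sP|apply: tQ] => xr xrs; apply: K'P;
  by rewrite mem_cat xrs ?orbT.
Qed.

Lemma upper_near_mono K P Q : (forall K', P K' -> Q K') ->
  upper_near K P -> upper_near K Q.
Proof. by move=> PQ [s [sK sP]]; exists s; split => // K' /sP/PQ. Qed.

Lemma upper_near_mxnorm K m n (M : 'M[starAlg_of A]_(m, n)) (r : R) :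
  mxnorm (@qnorm R A K) (map_mx (qpi K) M) < r ->
  upper_near K (fun K' => mxnorm (@qnorm R A K') (map_mx (qpi K') M) < r).
Proof.
rewrite mxnorm_qpi; set a := mxnorm _ _ => ar.
(* The slack is shared among the [m n] entries; the extra 1 keeps the final inequality strict and
   the denominator nonzero. *)
pose e := (r - a) / (m * n).+1%:R.
have e0 : 0 < e by rewrite divr_gt0// subr_gt0.
exists [seq ((M ij.1 ij.2 : A), dist_to (M ij.1 ij.2) K + e)
  | ij <- enum {: 'I_m * 'I_n}].
split=> [_ /mapP[ij _ ->]|K' K'P]; first by rewrite /= ltrDl.
rewrite mxnorm_qpi.
apply: (@le_lt_trans _ _ (\sum_(i < m) \sum_(j < n) (dist_to (M i j) K + e))).
  apply: ler_sum => i _; apply: ler_sum => j _; apply/ltW.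
  by apply: (K'P (_, _)); apply/mapP; exists (i, j) => //; rewrite mem_enum.
under eq_bigr do rewrite big_split/=.
rewrite big_split/= -/a -ltrBrDl.
rewrite (eq_bigr (fun _ => e *+ n)) => [|i _]; last by rewrite sumr_const card_ord.
rewrite sumr_const card_ord -mulrnA -mulr_natr mulnC /e mulrAC ltr_pdivrMr//.
by rewrite ltr_pM2l ?subr_gt0// ltr_nat.
Qed.
End NearIdeal.

(** * Codes for projections and the stability of their relations *)

Definition mx_mvn (C : numClosedFieldType) (S : starAlg C) m n
    (p : 'M[S]_m) (q : 'M[S]_n) : Prop :=
  exists v : 'M[S]_(n, m), mxstar v *m v = p /\ v *m mxstar v = q.

Definition proj_code : countType := {n : nat & ('M[nat]_n * nat)%type}.

Section Codes.
Variables (R : realType) (A : cstarAlg R) (d : nat -> A).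
Implicit Types (K : closed_ideal A) (i j k : proj_code).
Local Notation B := (starAlg_of A).
Local Notation D K := (mxnorm (@qnorm R A K)).
Local Notation pi K := (map_mx (qpi K)).

Definition code_mx i : 'M[B]_(tag i) :=
  map_mx (d : nat -> B) (tagged i : 'M[nat]_(tag i) * nat).1.

Definition code_bound i : R := ((tagged i : 'M[nat]_(tag i) * nat).2)%:R.

(** Half the tolerance, so that two matrices represented by one code lie within [mvn_tol] of each
    other. *)
Definition code_tol i : R := mvn_tol (code_bound i) / 2.

Definition represents K i (P : 'M[quotient_algebra K]_(tag i)) :=
  [/\ P *m P = P, mxstar P = P, D K P < code_bound i &
      D K (pi K (code_mx i) - P) < code_tol i].

Definition code_sum_rel i j k : set (closed_ideal A) := [set K |
  exists P Q T, [/\ @represents K i P, @represents K j Q, @represents K k T &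
    mx_mvn (block_mx P 0 0 Q) T]].

(** [P] itself serves as the approximate partial isometry from [P] to [Q]: one relation is exact,
    the other is the distance between [P] and [Q]. *)
Lemma represents_mvn K i P Q : @represents K i P -> @represents K i Q -> mx_mvn P Q.
Proof.
move=> [PP Ps Pl Pt] [QQ Qs Ql Qt]; have HN := qnorm_banach K.
apply: (mvn_near HN (v := P) (M := code_bound i)) => //; try exact: ltW.
  by rewrite Ps PP subrr mxnorm0// ltW// mvn_tol_gt0.
rewrite Ps PP; apply: (le_trans (mxnormB_trans HN (pi K (code_mx i)) _ _)).
rewrite mxnormBC//; move: Pt Qt; rewrite /code_tol; lra.
Qed.

(** The lift [P'] is almost idempotent in the quotients near [K], and [projection_near] corrects it
    there. The inequalities in [represents] are strict, so their slack absorbs the correction. *)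
Lemma represents_near K i P (P' : 'M[B]_(tag i)) (e : R) :
  @represents K i P -> mxstar P' = P' -> pi K P' = P -> 0 < e ->
  upper_near K (fun K' => exists2 Q, @represents K' i Q &
    D K' (pi K' P' - Q) <= e).
Proof.
move=> [PP Ps Pl Pt] P's P'E e0.
set l := code_bound i in Pl *; set t := code_tol i in Pt *.
(* At most half of each slack: one half is spent on moving [K], the other on passing from [P'] to
   [Q]. The cap 1 is required by [projection_near]. *)
pose e' := Num.min (Num.min e 1) (Num.min ((l - D K P) / 2)
  ((t - D K (pi K (code_mx i) - P)) / 2)).
have e'0 : 0 < e' by rewrite !lt_min e0 ltr01 !divr_gt0// subr_gt0.
have e'e : e' <= e by rewrite /e' !ge_min lexx.
have e'1 : e' <= 1 by rewrite /e' !ge_min lexx orbT.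
have e'l : e' <= (l - D K P) / 2 by rewrite /e' !ge_min lexx !orbT.
have e't : e' <= (t - D K (pi K (code_mx i) - P)) / 2.
  by rewrite /e' !ge_min lexx !orbT.
(* The norm in [A] dominates the norm in every quotient, so [M] and [c] do not depend on [K']. *)
pose M := mxnorm (@rnorm R A) P'.
have M0 : 0 <= M by do 2 (apply: sumr_ge0 => ? _); exact: rnorm_ge0.
have M3 : 0 < 2 * M + 3 by lra.
pose c := Num.min 8^-1 (e' / (2 * (2 * M + 3))).
have c0 : 0 < c by rewrite lt_min invr_gt0 ltr0n divr_gt0// mulr_gt0.
have c8 : c <= 8^-1 by rewrite ge_min lexx.
have ce : 2 * (c * (2 * M + 3)) <= e'.
  rewrite mulrCA -ler_pdivlMr ?mulr_gt0//.
  by rewrite ge_min lexx orbT.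
have n1 : upper_near K (fun K' => D K' (pi K' (P' *m P' - P')) < c).
  apply: upper_near_mxnorm; rewrite map_mxB map_mxM P'E PP subrr.
  by rewrite (mxnorm0 (qnorm_banach K)).
have n2 : upper_near K (fun K' => D K' (pi K' P') < l - e').
  by apply: upper_near_mxnorm; rewrite P'E; lra.
have n3 : upper_near K (fun K' => D K' (pi K' (code_mx i - P')) < t - e').
  by apply: upper_near_mxnorm; rewrite map_mxB P'E; lra.
apply: upper_near_mono (upper_near_and n1 (upper_near_and n2 n3)).
move=> K' [k1 [k2 k3]]; have HN := qnorm_banach K'.
have [||||Q [QQ Qs QP]] :=
    projection_near HN (x := pi K' P') (M := M) (d := c) _ _ _ c0 c8.
- by rewrite mxstar_qpi P's.
- exact: mxnorm_qpi_le.
- by rewrite -map_mxM -map_mxB ltW.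
- exact: le_trans ce e'1.
have {}QP := le_trans QP ce.
exists Q; last exact: le_trans QP e'e.
split=> //.
  have := mxnormB HN (pi K' P') (pi K' P' - Q); rewrite subKr -/l; lra.
apply: (le_lt_trans (mxnormB_trans HN (pi K' P') _ _)).
by move: k3; rewrite map_mxB -/t; lra.
Qed.

(** Lift the three projections and the partial isometry. Near [K] the projections are corrected by
    [represents_near], while the lift of [v] still almost implements the equivalence and [mvn_near]
    makes it exact. *)
Lemma code_sum_near i j k K : code_sum_rel i j k K ->
  upper_near K (code_sum_rel i j k).
Proof.
move=> [P [Q [T [rP rQ rT [v [vP vT]]]]]].
have [_ Ps _ _] := rP; have [_ Qs _ _] := rQ; have [_ Ts _ _] := rT.
have [P' P's P'E] := mx_qpi_lift_selfadj Ps.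
have [Q' Q's Q'E] := mx_qpi_lift_selfadj Qs.
have [T' T's T'E] := mx_qpi_lift_selfadj Ts.
have [V VE] := mx_qpi_surj v.
pose N0 m n (M : 'M[B]_(m, n)) := mxnorm (@rnorm R A) M.
have N0_ge0 m n (M : 'M[B]_(m, n)) : 0 <= N0 m n M.
  by do 2 (apply: sumr_ge0 => ? _); exact: rnorm_ge0.
(* The [+ 2] covers the corrected block sum, whose two blocks each move by at most [e <= 1]. *)
pose M := N0 _ _ V + N0 _ _ P' + N0 _ _ Q' + N0 _ _ T' + 2.
have [V0 P0] := (N0_ge0 _ _ V, N0_ge0 _ _ P').
have [Q0 T0] := (N0_ge0 _ _ Q', N0_ge0 _ _ T').
have M0 : 0 <= M by rewrite /M; lra.
have t0 := mvn_tol_gt0 M0.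
(* The larger defect is at most a quarter of the tolerance from [V] plus [e] for each of the two
   blocks. *)
pose e := Num.min 1 (mvn_tol M / 4).
have e0 : 0 < e by rewrite lt_min ltr01 divr_gt0.
have e1 : e <= 1 by rewrite ge_min lexx.
have et : e <= mvn_tol M / 4 by rewrite ge_min lexx orbT.
have nP := represents_near rP P's P'E e0.
have nQ := represents_near rQ Q's Q'E e0.
have nT := represents_near rT T's T'E e0.
have n1 : upper_near K (fun K' =>
    D K' (pi K' (mxstar V *m V - block_mx P' 0 0 Q')) < mvn_tol M / 4).
  apply: upper_near_mxnorm; rewrite map_mxB map_mxM -mxstar_qpi VE vP.
  rewrite map_block_mx !map_mx0 P'E Q'E subrr (mxnorm0 (qnorm_banach K)).
  by rewrite divr_gt0.
have n2 : upper_near K (fun K' =>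
    D K' (pi K' (V *m mxstar V - T')) < mvn_tol M / 4).
  apply: upper_near_mxnorm; rewrite map_mxB map_mxM -mxstar_qpi VE vT.
  by rewrite T'E subrr (mxnorm0 (qnorm_banach K)) divr_gt0.
apply: upper_near_mono (upper_near_and (upper_near_and nP (upper_near_and nQ nT))
  (upper_near_and n1 n2)).
move=> K' [[[p rp pP] [[q rq qQ] [t rt tT]]] [k1 k2]].
have HN := qnorm_banach K'.
have [pp ps _ _] := rp; have [qq qs _ _] := rq; have [tt ts _ _] := rt.
have bound n (x : 'M[B]_n) y : D K' (pi K' x - y) <= e -> D K' y <= N0 _ _ x + 1.
  move=> xy; have := mxnormB HN (pi K' x) (pi K' x - y); rewrite subKr.
  have := mxnorm_qpi_le K' x; rewrite -/(N0 _ _ x); lra.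
exists p, q, t; split => //.
apply: (mvn_near HN (v := pi K' V) (M := M)) => //.
- by rewrite mulmx_block !mulmx0 !mul0mx !addr0 !add0r pp qq.
- by rewrite mxstar_block !mxstar0 ps qs.
- rewrite mxnorm_block_diag//; have := bound _ _ _ pP; have := bound _ _ _ qQ.
  by rewrite /M; lra.
- by have := bound _ _ _ tT; rewrite /M; lra.
- by have := mxnorm_qpi_le K' V; rewrite -/(N0 _ _ V) /M; lra.
- rewrite mxstar_qpi -map_mxM.
  apply: (le_trans (mxnormB_trans HN (pi K' (block_mx P' 0 0 Q')) _ _)).
  rewrite -map_mxB; apply: (le_trans (lerD (ltW k1) (lexx _))).
  rewrite map_block_mx !map_mx0.
  rewrite opp_block_mx add_block_mx !oppr0 !addr0 mxnorm_block_diag//.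
  by lra.
rewrite mxstar_qpi -map_mxM.
apply: (le_trans (mxnormB_trans HN (pi K' T') _ _)); rewrite -map_mxB.
by move: k2; lra.
Qed.

Definition code_valid i : set (closed_ideal A) := [set K | exists P, @represents K i P].

Lemma code_valid_near i K : code_valid i K -> upper_near K (code_valid i).
Proof.
move=> [P rP]; have [_ Ps _ _] := rP.
have [P' P's P'E] := mx_qpi_lift_selfadj Ps.
by apply: upper_near_mono (represents_near rP P's P'E ltr01) => K' [Q rQ _]; exists Q.
Qed.

Hypothesis d_dense : forall x (e : R), 0 < e -> exists n, rnorm (x - d n) < e.

Lemma represents_exists K n (P : 'M[quotient_algebra K]_n) :
  P *m P = P -> mxstar P = P ->
  exists c l, @represents K (Tagged (fun n => ('M[nat]_n * nat)%type) (c, l)) P.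
Proof.
move=> PP Ps; have HN := qnorm_banach K.
(* The norm bound comes first because the tolerance, and so the precision [e] of the entries,
   depends on it. *)
pose l := Num.bound (D K P).
have Pl : D K P < l%:R by rewrite archi_boundP// mxnorm_ge0.
have t0 : 0 < mvn_tol (l%:R : R) / 2 by rewrite divr_gt0// mvn_tol_gt0.
have [P' P'E] := mx_qpi_surj P.
pose e : R := mvn_tol (l%:R : R) / 2 / (n * n).+1%:R.
have e0 : 0 < e by rewrite divr_gt0.
have [c cP] := choice (fun ij : 'I_n * 'I_n => d_dense (P' ij.1 ij.2) e0).
exists (\matrix_(i, j) c (i, j)), l; split => //.
rewrite mxnormBC// -P'E -map_mxB; apply: (le_lt_trans (mxnorm_qpi_le _ _)).
apply: (@le_lt_trans _ _ (\sum_(i < n) \sum_(j < n) e)).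
  apply: ler_sum => i _; apply: ler_sum => j _; rewrite !mxE.
  exact: ltW (cP (i, j)).
rewrite (eq_bigr (fun _ => e *+ n)) => [|i _]; last by rewrite sumr_const card_ord.
rewrite sumr_const card_ord -mulrnA -mulr_natr /e mulrAC ltr_pdivrMr//.
by rewrite ltr_pM2l// ltr_nat.
Qed.
End Codes.

(** * Countable unions, F-sigma sets and Borel sets *)

Lemma bigcup_unpickle (X : Type) (T : countType) (F : T -> set X) :
  \bigcup_t F t = \bigcup_n (if unpickle n is Some t then F t else set0).
Proof.
apply/seteqP; split=> x [t _ Fx]; last first.
  by case: unpickle Fx => [s Fs|//]; exists s.
by exists (pickle t) => //; rewrite pickleK.
Qed.

Section FsigmaTheory.
Variable X : topologicalType.
Implicit Types U V : set X.

Lemma Fsigma_set0 : Fsigma (set0 : set X).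
Proof. exact: closed_Fsigma closed0. Qed.

Lemma Fsigma_bigcup (T : countType) (F : T -> set X) :
  (forall t, Fsigma (F t)) -> Fsigma (\bigcup_t F t).
Proof.
move=> FF; have ex t : exists G : (set X)^nat,
    (forall i, closed (G i)) /\ F t = \bigcup_i G i.
  by have [G Gc GE] := FF t; exists G.
have [G GP] := choice ex.
pose H (ti : T * nat) := G ti.1 ti.2.
exists (fun n => if unpickle n is Some ti then H ti else set0).
  by move=> n; case: unpickle => [ti|]; [apply: (GP ti.1).1 | exact: closed0].
rewrite -bigcup_unpickle; apply/seteqP; split=> [x [t _]|x [[t i] _ Gx]].
  by rewrite (GP t).2 => -[i _ Gx]; exists (t, i).
by exists t => //; rewrite (GP t).2; exists i.
Qed.

Lemma Fsigma_setI U V : Fsigma U -> Fsigma V -> Fsigma (U `&` V).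
Proof.
move=> [F Fc ->] [G Gc ->].
have -> : (\bigcup_i F i) `&` (\bigcup_i G i) =
    \bigcup_(ij : nat * nat) (F ij.1 `&` G ij.2).
  apply/seteqP; split=> [x [[i _ Fx] [j _ Gx]]|x [[i j] _ [Fx Gx]]].
    by exists (i, j).
  by split; [exists i | exists j].
apply: Fsigma_bigcup => ij; apply: closed_Fsigma.
by apply: closedI; [exact: Fc | exact: Gc].
Qed.

Lemma Fsigma_seq_all (T : eqType) (s : seq T) (F : T -> set X) :
  (forall t, Fsigma (F t)) -> Fsigma [set x | forall t, t \in s -> F t x].
Proof.
move=> FF; elim: s => [|t s IHs].
  rewrite (_ : [set x | _] = setT); first exact/closed_Fsigma/closedT.
  by apply/seteqP; split.
rewrite (_ : [set x | _] = F t `&` [set x | forall t, t \in s -> F t x]).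
  exact: Fsigma_setI.
apply/seteqP; split=> [x Px|x [Ftx Fx] u].
  by split=> [|u us]; apply: Px; rewrite in_cons ?eqxx ?us ?orbT.
by rewrite in_cons => /orP[/eqP->//|/Fx].
Qed.

Lemma borel_setC U : borel_sets U -> borel_sets (~` U).
Proof. by move=> BU; rewrite -setTD; exact: sigma_algebraCD. Qed.

Lemma borel_bigcup (T : countType) (F : T -> set X) :
  (forall t, borel_sets (F t)) -> borel_sets (\bigcup_t F t).
Proof.
move=> BF; rewrite bigcup_unpickle; apply: sigma_algebra_bigcup => n.
by case: unpickle => [t|]; [exact: BF | exact: sigma_algebra0].
Qed.

Lemma borel_open U : open U -> borel_sets U.
Proof. by move=> oU; apply: sub_sigma_algebra. Qed.

Lemma borel_Fsigma U : Fsigma U -> borel_sets U.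
Proof.
move=> [F Fc ->]; apply: borel_bigcup => n.
by rewrite -[F n]setCK; apply: borel_setC; apply: borel_open; rewrite openC.
Qed.

Lemma borel_seq_all (T : eqType) (s : seq T) (F : T -> set X) :
  (forall t, borel_sets (F t)) -> borel_sets [set x | forall t, t \in s -> F t x].
Proof.
move=> BF; elim: s => [|t s IHs].
  rewrite (_ : [set x | _] = setT); first by apply: borel_open; exact: openT.
  by apply/seteqP; split.
(* A binary intersection as the complement of a union over [bool]. *)
rewrite (_ : [set x | _] =
    ~` \bigcup_(b : bool) ~` (if b then F t else [set x | forall t, t \in s -> F t x])).
  by apply: borel_setC; apply: borel_bigcup => -[]; apply: borel_setC.
apply/seteqP; split=> [x Px [[] _]|x Px u].
- by apply; apply: Px; rewrite in_cons eqxx.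
- by apply=> u us; apply: Px; rewrite in_cons us orbT.
rewrite in_cons => /orP[/eqP->|us]; apply: contrapT => Fx; apply: Px.
  by exists true.
by exists false => //; move/(_ u us).
Qed.
End FsigmaTheory.

(** * Borel maps into the space of subgroups *)

Lemma prod_bool_open_cylinder (V : choiceType)
    (O : set (prod_topology (fun _ : V => bool)))
    (f : prod_topology (fun _ : V => bool)) : open O -> O f ->
  exists s : seq V, forall g, (forall z, z \in s -> g z = f z) -> O g.
Proof.
move=> oO Of.
(* The sets that contain a cylinder around [f] form a filter; it converges to [f] in every
   coordinate, hence in the product. *)
pose F : set_system (forall _ : V, bool) := fun P =>
  exists s : seq V, forall g, (forall z, z \in s -> g z = f z) -> P g.
have FF : Filter F.
  split=> [|P Q [s sP] [t tQ]|P Q PQ [s sP]]; first by exists [::].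
    exists (s ++ t) => g gf; split; [apply: sP|apply: tQ] => z zs;
      by apply: gf; rewrite mem_cat zs ?orbT.
  by exists s => g /sP/PQ.
have : F --> f.
  apply/cvg_sup => z U; rewrite nbhsE => -[_ [[W _ <-] Wf] WU].
  by exists [:: z] => g gf; apply: WU; rewrite /= gf ?inE.
by apply; apply: open_nbhs_nbhs.
Qed.

(** As [V] is countable through [e], the preimage of an open set is a countable union of sets that
    prescribe finitely many values [kappa x z]. Borel sets follow, being generated by the open
    ones. *)
Lemma borel_map_subgroup (X : topologicalType) (V : zmodType) (T : countType)
    (e : T -> V) (kappa : X -> subgroup V) :
  (forall z, exists t, e t = z) ->
  (forall z, borel_sets [set x | kappa x z]) -> borel_map kappa.
Proof.
move=> e_surj Bk.
suff Bo O : open O -> borel_sets (kappa @^-1` O).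
  have: sigma_algebra setT [set B : set (subgroup V) | borel_sets (kappa @^-1` B)].
    split=> [|B BB|F BF]; rewrite /= ?preimage_set0.
    - exact: sigma_algebra0.
    - by rewrite setTD preimage_setC; exact: borel_setC.
    - by rewrite preimage_bigcup; exact: sigma_algebra_bigcup.
  by move=> sB B BB; exact: BB _ (conj sB Bo).
move=> [W oW OE].
pose C (s : seq (T * bool)) : set X :=
  [set x | forall tb, tb \in s -> kappa x (e tb.1) = tb.2].
have BC s : borel_sets (C s).
  apply: (@borel_seq_all _ _ s
    (fun tb => [set x | kappa x (e tb.1) = tb.2])) => -[t []]/=.
    exact: Bk.
  rewrite (_ : [set x | _] = ~` [set x | kappa x (e t)]).
    by apply: borel_setC; exact: Bk.
  by apply/seteqP; split=> x /=; [move=> -> | move/negP/negbTE].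
rewrite (_ : _ @^-1` _ = \bigcup_s (if `[< C s `<=` kappa @^-1` O >] then C s else set0)).
  apply: borel_bigcup => s; case: ifP => _; first exact: BC.
  exact: sigma_algebra0.
apply/seteqP; split=> [x Ox|x [s _]]; last by case: ifPn => // /asboolP; apply.
have [t tP] := choice e_surj.
have Ofx : W (subgroup_incl (kappa x)) by move: Ox; rewrite -OE.
have [s sP] := prod_bool_open_cylinder oW Ofx.
exists [seq (t z, kappa x z) | z <- s] => //.
rewrite asboolT => [_ /mapP[z zs ->]|y Cy]; first by rewrite /= tP.
rewrite -OE; apply: sP => z zs; have := Cy (t z, kappa x z); rewrite /= tP; apply.
by apply/mapP; exists z.
Qed.

(** * Stable conditions in the Wijsman topology *)

Section WijsmanTopology.
Variables (R : realType) (A : cstarAlg R).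

Lemma dist_to_continuous (x : A) : continuous (@dist_to R A x).
Proof.
move=> K U; rewrite nbhsE => -[W [oW WK] WU].
have /cvg_sup/(_ x) : nbhs K --> K by [].
apply; rewrite nbhsE; exists (@dist_to R A x @^-1` W); first by split=> //; exists W.
by move=> K' /WU.
Qed.

Lemma dist_to_le_closed (x : A) (r : R) : closed [set K | dist_to x K <= r].
Proof.
apply: (@closed_comp _ _ (@dist_to R A x) [set y | y <= r]); last exact: closed_le.
by move=> K _; exact: dist_to_continuous.
Qed.

Lemma separable_dense_seq : separable_space A ->
  exists d : nat -> A, forall x (e : R), 0 < e -> exists n, rnorm (x - d n) < e.
Proof.
move=> [D /countable_injP[f finj] Dd].
(* Indices outside the range of [f] on [D] get the value 0, which does not affect density. *)
pose d n : A := if pselect (exists2 x, D x & f x = n) is left ex then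
  projT1 (cid2 ex) else 0.
exists d => x e e0.
have e0c : 0 < e%:C by rewrite ltcR.
have [|y [xy Dy]] := Dd (ball x e%:C) _ (ball_open _ _).
  by exists x; exact: ballxx.
exists (f y); rewrite /d; case: pselect => [ex|[]]; last by exists y.
case: cid2 => z Dz /= fz; have -> : z = y by apply: finj => //; rewrite inE.
by move: xy; rewrite -ball_normE /ball_/= rnormE ltcR.
Qed.

(** Distances are 1-Lipschitz in the point, so [dist_to x K < r] can be sharpened to a condition
    [dist_to (d n) K <= q] with [q] rational. Such conditions are closed and have only countably
    many finite families; [U] is the union of the sets so defined that it contains. *)
Lemma upper_open_Fsigma (U : set (closed_ideal A)) : separable_space A ->
  (forall K, U K -> upper_near K U) -> Fsigma U.
Proof.
move=> /separable_dense_seq[d d_dense] Un.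
pose C (s : seq (nat * rat)) : set (closed_ideal A) :=
  [set K | forall nq, nq \in s -> dist_to (d nq.1) K <= ratr nq.2].
rewrite (_ : U = \bigcup_s (if `[< C s `<=` U >] then C s else set0)).
  apply: Fsigma_bigcup => s; case: ifP => _; last exact: Fsigma_set0.
  apply: (@Fsigma_seq_all _ _ s (fun nq => [set K | dist_to (d nq.1) K <= ratr nq.2])).
  by move=> nq; apply/closed_Fsigma/dist_to_le_closed.
apply/seteqP; split=> [K UK|K [s _]]; last by case: ifPn => // /asboolP; apply.
have [s [sK sU]] := Un _ UK.
have ex (xr : A * R) : exists nq : nat * rat, dist_to xr.1 K < xr.2 ->
    dist_to (d nq.1) K <= ratr nq.2 /\
    forall K', dist_to (d nq.1) K' <= ratr nq.2 -> dist_to xr.1 K' < xr.2.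
  have [lt|] := boolP (dist_to xr.1 K < xr.2); last by exists (0%N, 0).
  (* Replacing the point by [d n] costs [e] each way and [q] is below the distance plus [2 e], so
     [dist_to xr.1 K'] stays below the distance at [K] plus [3 e], hence below [xr.2]. *)
  pose e := (xr.2 - dist_to xr.1 K) / 4.
  have e0 : 0 < e by rewrite divr_gt0// subr_gt0.
  have [n ne] := d_dense xr.1 e e0.
  have [q] := @rat_in_itvoo R (dist_to xr.1 K + e) (dist_to xr.1 K + 2 * e) ltac:(lra).
  rewrite in_itv/= => /andP[q1 q2]; exists (n, q) => _; split=> [|K' K'q] /=.
    have := dist_to_lip K (d n) xr.1; rewrite -rnormN opprB; lra.
  have := dist_to_lip K' xr.1 (d n); move: K'q q2 ne => /=; rewrite /e; lra.
have [g gP] := choice ex.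
exists [seq g xr | xr <- s] => //; rewrite asboolT => [_ /mapP[xr xrs ->]|K' CK'].
  by have [] := gP xr (sK _ xrs).
apply: sU => xr xrs; have [_] := gP xr (sK _ xrs); apply.
by apply: CK'; apply/mapP; exists xr.
Qed.

(** Upper conditions are open by continuity of the distances, so the complement is even closed. This
    handles the relators of codes that represent nothing. *)
Lemma upper_closed_Fsigma (U : set (closed_ideal A)) :
  (forall K, U K -> upper_near K U) -> Fsigma (~` U).
Proof.
move=> Un; apply: closed_Fsigma; rewrite closedC openE => K UK.
have [s [sK sU]] := Un _ UK; apply: (@filterS _ (nbhs K) _ _ _ sU).
elim: s sK {sU} => [_|[x r] s IHs sK].
  by apply: filterS (@filterT _ (nbhs K) _) => K' _ xr.
have n1 : nbhs K [set K' | dist_to x K' < r].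
  apply: (@dist_to_continuous x K [set y | y < r]); apply: open_nbhs_nbhs; split.
    exact: open_lt.
  by apply: (sK (x, r)); rewrite in_cons eqxx.
have n2 : nbhs K [set K' | forall xr, xr \in s -> dist_to xr.1 K' < xr.2].
  by apply: IHs => xr xrs; apply: sK; rewrite in_cons xrs orbT.
apply: filterS2 n1 n2 => K' h1 h2 xr.
by rewrite in_cons => /orP[/eqP->//|/h2].
Qed.
End WijsmanTopology.

(** * Presenting a Grothendieck group by generators and relators *)

Section GeneratedSubgroup.
Variables (V : zmodType) (T : eqType) (v : T -> V) (P : T -> Prop).

Definition gen_comb (s : seq (int * T)) : V := \sum_(ct <- s) v ct.2 *~ ct.1.

(** Membership is witnessed by an explicit list, so that it can later be written as a countable
    union over lists. *)
Definition gen_mem (z : V) : bool := `[< exists s : seq (int * T),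
  (forall ct, ct \in s -> P ct.2) /\ gen_comb s = z >].

Lemma gen_mem_zmod_closed : zmod_closed gen_mem.
Proof.
split=> [|x y /asboolP[s [sP <-]] /asboolP[t [tP <-]]]; apply/asboolP.
  by exists [::]; split=> //; rewrite /gen_comb big_nil.
exists (s ++ [seq (- ct.1, ct.2) | ct <- t]); split.
  by move=> ct; rewrite mem_cat => /orP[/sP//|/mapP[ct' /tP ? ->]].
rewrite /gen_comb big_cat big_map/=; congr (_ + _).
by rewrite -sumrN; apply: eq_bigr => ct _; rewrite mulrNz.
Qed.

Definition gen_subgroup : subgroup V := Subgroup gen_mem_zmod_closed.

Lemma gen_subgroup_gen t : P t -> v t \in subgroup_pred gen_subgroup.
Proof.
move=> Pt; apply/asboolP; exists [:: (1, t)]; split=> [ct|].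
  by rewrite inE => /eqP->.
by rewrite /gen_comb big_seq1.
Qed.

Lemma gen_subgroup_ker (U : zmodType) (f : {additive V -> U}) z :
  (forall t, P t -> f (v t) = 0) -> z \in subgroup_pred gen_subgroup -> f z = 0.
Proof.
move=> f0 /asboolP[s [sP <-]]; rewrite raddf_sum big_seq big1// => ct cts.
by rewrite raddfMz f0 ?mul0rz//; exact: sP.
Qed.
End GeneratedSubgroup.

Definition zgen (k : nat) : Zfin := [freeg [:: (1, k)]].

Lemma Zfin_ind (P : Zfin -> Prop) :
  P 0 -> (forall x y, P x -> P y -> P (x - y)) -> (forall k, P (zgen k)) ->
  forall z, P z.
Proof.
move=> P0 PB Pg z.
have PN x : P x -> P (- x) by move=> Px; rewrite -sub0r; exact: PB.
have PD x y : P x -> P y -> P (x + y).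
  by move=> Px Py; rewrite -[y]opprK; apply: PB => //; exact: PN.
have PMn x n : P x -> P (x *+ n).
  by move=> Px; elim: n => [|n IHn]; rewrite ?mulr0n// mulrS; exact: PD.
rewrite -(freeg_sumE z); apply: big_ind => // k _.
rewrite -[coeff k z]intz -freegU_mulz; case: (coeff k z) => n.
  by apply: PMn; exact: Pg.
by apply: PN; apply: PMn; exact: Pg.
Qed.

Section Presentation.
Variables (M : nmodType) (valid : nat -> Prop) (cl : nat -> M).
Hypothesis cl_surj : forall m, exists k, valid k /\ cl k = m.
Hypothesis cl_invalid : forall k, ~ valid k -> cl k = 0.

Definition relator (t : nat * nat * nat + nat) : Zfin :=
  match t with
  | inl (i, j, k) => zgen i + zgen j - zgen k
  | inr i => zgen i
  end.

Definition relator_holds (t : nat * nat * nat + nat) : Prop :=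
  match t with
  | inl (i, j, k) => [/\ valid i, valid j, valid k & cl i + cl j = cl k]
  | inr i => ~ valid i
  end.

Definition presentation : subgroup Zfin := gen_subgroup relator relator_holds.

Local Notation H := (subgroup_pred presentation).
Local Notation G := (grothendieck M).

Definition groth_class (m : M) : G := \pi_G (m, 0).

Lemma groth_classD m n : groth_class (m + n) = groth_class m + groth_class n.
Proof. by rewrite [RHS]groth_add_pi /= addr0. Qed.

Lemma groth_class0 : groth_class 0 = 0. Proof. by []. Qed.

Lemma groth_pi_sub m n : \pi_G (m, n) = groth_class m - groth_class n.
Proof. by rewrite [- _]groth_opp_pi [RHS]groth_add_pi /= addr0 add0r. Qed.

Definition pres_lift (z : Zfin) : G :=
  fglift (fun k => groth_class (cl k) : zmodule G) z.

Lemma pres_lift_is_zmod_morphism : zmod_morphism pres_lift.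
Proof.
exact (lift_is_additive (fun k => groth_class (cl k) : zmodule G)).
Qed.

HB.instance Definition _ :=
  GRing.isZmodMorphism.Build Zfin G pres_lift pres_lift_is_zmod_morphism.

Lemma pres_lift_gen k : pres_lift (zgen k) = groth_class (cl k).
Proof. by rewrite /pres_lift liftU scale1r. Qed.

Lemma pres_lift_ker z : z \in H -> pres_lift z = 0.
Proof.
apply: (gen_subgroup_ker (f := pres_lift)) => -[[[i j] k]|i] /=.
  move=> [_ _ _ ijk]; rewrite raddfB raddfD /= !pres_lift_gen -groth_classD ijk.
  by rewrite subrr.
by move=> /cl_invalid iE; rewrite pres_lift_gen iE groth_class0.
Qed.

Lemma relator_mem i j k : valid i -> valid j -> valid k -> cl i + cl j = cl k ->
  zgen i + zgen j - zgen k \in H.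
Proof.
by move=> *; apply: (@gen_subgroup_gen _ _ relator relator_holds (inl (i, j, k))).
Qed.

(** Sums of generators collapse modulo the relators, because the sum of two classes is again the
    class of a valid generator. *)
Lemma pres_difference z : exists i j,
  [/\ valid i, valid j & z - (zgen i - zgen j) \in H].
Proof.
(* A valid name of the class 0; [zgen a] lies in the subgroup, being the relator
   [zgen a + zgen a - zgen a]. *)
have [a [av a0]] := cl_surj 0.
elim/Zfin_ind: z => [|x y [i [j [iv jv xij]]] [k [l [kv lv ykl]]]|k].
- by exists a, a; split=> //; rewrite !subrr rpred0.
- have [m [mv mE]] := cl_surj (cl i + cl l).
  have [n [nv nE]] := cl_surj (cl j + cl k).
  exists m, n; split=> //.
  have r1 := relator_mem iv lv mv (esym mE).
  have r2 := relator_mem jv kv nv (esym nE).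
  have -> : x - y - (zgen m - zgen n) =
      (x - (zgen i - zgen j) - (y - (zgen k - zgen l)))
      + (zgen i + zgen l - zgen m - (zgen j + zgen k - zgen n)).
    rewrite !opprD !opprK !addrA.
    rewrite [RHS](ACl (1*4*9*12*(7*2)*(3*10)*(5*11)*(8*6)))/=.
    by rewrite !subrr !addr0.
  by rewrite rpredD// rpredB.
have [kv|kv] := pselect (valid k).
  exists k, a; split=> //.
  have -> : zgen k - (zgen k - zgen a) = zgen a + zgen a - zgen a.
    by rewrite opprB addrCA subrr addr0 addrK.
  by apply: relator_mem => //; rewrite a0 addr0.
exists a, a; split=> //; rewrite subrr subr0.
exact: (@gen_subgroup_gen _ _ relator relator_holds (inr k)).
Qed.

(** By [pres_difference] only [zgen i - zgen j] matters. Equal images mean [cl i + t = cl j + t] for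
    some [t]; once [t] and this sum are named by generators, two relators with the same last term
    identify [zgen i] and [zgen j]. *)
Lemma pres_lift_inj z : pres_lift z = 0 -> z \in H.
Proof.
have [i [j [iv jv zij]]] := pres_difference z.
move=> z0; have : groth_class (cl i) = groth_class (cl j).
  have := pres_lift_ker zij; rewrite !raddfB /= !pres_lift_gen z0 add0r opprK.
  by move/eqP; rewrite addrC subr_eq0 => /eqP.
move=> /groth_pi[t ijt]; rewrite /= !addr0 in ijt.
have [k [kv kE]] := cl_surj t.
have [m [mv mE]] := cl_surj (cl i + cl k).
have r1 := relator_mem iv kv mv (esym mE).
have r2 : zgen j + zgen k - zgen m \in H.
  by apply: relator_mem => //; rewrite mE kE.
have -> : z = (z - (zgen i - zgen j))
    + (zgen i + zgen k - zgen m - (zgen j + zgen k - zgen m)).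
  rewrite !opprD !opprK !addrA [RHS](ACl (1*(4*2)*(3*7)*(5*8)*(9*6)))/=.
  by rewrite !subrr !addr0.
by rewrite rpredD// rpredB.
Qed.

Lemma presentation_iso : group_isomorphic (quotient_group presentation) G.
Proof.
pose Q := Quotient.quot H.
have piP (x y : Zfin) : \pi_Q x = \pi_Q y <-> x - y \in H.
  split=> [/eqP|Hxy]; first by rewrite -Quotient.idealrBE.
  by apply/eqP; rewrite -Quotient.idealrBE.
pose phi (a : Q) : G := pres_lift (repr a).
have phiE x : phi (\pi_Q x) = pres_lift x.
  apply/eqP; rewrite -subr_eq0 -raddfB; apply/eqP/pres_lift_ker/piP.
  by rewrite reprK.
have phiB : zmod_morphism phi.
  by elim/quotW=> x; elim/quotW=> y; rewrite -raddfB !phiE raddfB.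
pose F := GRing.isZmodMorphism.Build Q G phi phiB.
pose phiA : {additive Q -> G} := HB.pack phi F.
exists phiA.
have phi_inj : injective phi.
  elim/quotW=> x; elim/quotW=> y; rewrite !phiE => xy; apply/piP.
  by apply: pres_lift_inj; rewrite raddfB /= xy subrr.
have phi_surj g : exists a, phi a = g.
  elim/quotW: g => -[m n]; have [i [_ iE]] := cl_surj m.
  have [j [_ jE]] := cl_surj n; exists (\pi_Q (zgen i - zgen j)).
  by rewrite phiE raddfB /= !pres_lift_gen iE jE groth_pi_sub.
have [g gP] := choice phi_surj; exists g => // a.
by apply: phi_inj; rewrite gP.
Qed.
End Presentation.

(** * The codes present K0 of every quotient *)

Section CodeClasses.
Variables (R : realType) (A : cstarAlg R) (d : nat -> A).
Hypothesis d_dense : forall x (e : R), 0 < e -> exists n, rnorm (x - d n) < e.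
Implicit Type K : closed_ideal A.

Definition code0 : proj_code :=
  Tagged (fun n => ('M[nat]_n * nat)%type) (0 : 'M[nat]_0, 0%N).

(** Numbers that encode nothing fall back to [code0], whose norm bound 0 excludes every matrix, so
    the corresponding generators are killed. *)
Definition code (k : nat) : proj_code := odflt code0 (unpickle k).

Lemma codeK i : code (pickle i) = i.
Proof. by rewrite /code pickleK. Qed.

(** The size of [p] is a field of the record; an equation with a packed [Projection] avoids casts
    between matrix sizes. *)
Definition represents_proj K i (p : projection (quotient_algebra K)) :=
  exists P (PP : P *m P = P) (Ps : mxstar P = P),
    represents d (K := K) (i := i) P /\ p = Projection PP Ps.

Lemma represents_proj_mvn K i (p q : projection (quotient_algebra K)) :
  represents_proj i p -> represents_proj i q -> mvn p q.
Proof.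
move=> [P [PP [Ps [rP ->]]]] [Q [QQ [Qs [rQ ->]]]].
exact: represents_mvn rP rQ.
Qed.

Lemma represents_proj_exists K (p : projection (quotient_algebra K)) :
  exists i, represents_proj i p.
Proof.
case: p => n P PP Ps; have [c [l rP]] := represents_exists d_dense PP Ps.
by exists (Tagged (fun n => ('M[nat]_n * nat)%type) (c, l)), P, PP, Ps.
Qed.

Definition class_valid K k : Prop := code_valid d (code k) K.

(** The choice of [p] is immaterial by [represents_proj_mvn]; the default 0 agrees with the relator
    that kills an invalid code. *)
Definition code_class K k : Vmonoid (quotient_algebra K) :=
  if pselect (exists p : projection (quotient_algebra K),
    represents_proj (code k) p) is left ex
  then \pi_(Vmonoid (quotient_algebra K)) (projT1 (cid ex)) else 0.

Lemma code_class_pi K k (p : projection (quotient_algebra K)) :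
  represents_proj (code k) p -> code_class K k = \pi_(Vmonoid (quotient_algebra K)) p.
Proof.
move=> rp; rewrite /code_class; case: pselect => [ex|[]]; last by exists p.
by case: cid => q rq /=; apply/mvn_pi; exact: represents_proj_mvn rq rp.
Qed.

Lemma class_validP K k : class_valid K k <->
  exists p : projection (quotient_algebra K), represents_proj (code k) p.
Proof.
split=> [[P rP]|[p [P [PP [Ps [rP _]]]]]]; last by exists P.
by have [PP Ps _ _] := rP; exists (Projection PP Ps), P, PP, Ps.
Qed.

Lemma code_class_invalid K k : ~ class_valid K k -> code_class K k = 0.
Proof.
move=> kv; rewrite /code_class; case: pselect => // ex.
by case: kv; apply/class_validP.
Qed.

Lemma code_class_surj K (m : Vmonoid (quotient_algebra K)) :
  exists k, class_valid K k /\ code_class K k = m.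
Proof.
elim/quotW: m => p; have [i rp] := represents_proj_exists p.
exists (pickle i); rewrite -(codeK i) in rp; split; last exact: code_class_pi.
by apply/class_validP; exists p.
Qed.

(** Translates the relator condition on classes into the relation that [code_sum_near] shows to be
    stable. *)
Lemma code_sum_relP K i j k :
  code_sum_rel d (code i) (code j) (code k) K <->
  [/\ class_valid K i, class_valid K j, class_valid K k &
      code_class K i + code_class K j = code_class K k].
Proof.
split=> [[P [Q [T [rP rQ rT PQT]]]]|].
  split; [by exists P | by exists Q | by exists T |].
  have [PP Ps _ _] := rP; have [QQ Qs _ _] := rQ; have [TT Ts _ _] := rT.
  rewrite (@code_class_pi _ _ (Projection PP Ps)); last by exists P, PP, Ps.
  rewrite (@code_class_pi _ _ (Projection QQ Qs)); last by exists Q, QQ, Qs.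
  rewrite (@code_class_pi _ _ (Projection TT Ts)); last by exists T, TT, Ts.
  by rewrite [LHS]Vadd_pi; apply/mvn_pi.
move=> [/class_validP[p rp] /class_validP[q rq] /class_validP[t rt]].
rewrite (code_class_pi rp) (code_class_pi rq) (code_class_pi rt) [LHS]Vadd_pi.
move=> /mvn_pi; move: rp rq rt.
move=> [P [PP [Ps [rP ->]]]] [Q [QQ [Qs [rQ ->]]]] [T [TT [Ts [rT ->]]]] pqt.
by exists P, Q, T; split.
Qed.

Definition kappa_K0 K : subgroup Zfin := presentation (class_valid K) (code_class K).

(** For fixed [z], the lists whose combination of relators is [z] do not depend on [K]. Membership
    is a countable union, over these lists, of finite intersections of relator conditions; each is
    F-sigma, as a stable condition or as the complement of one. *)
Lemma kappa_K0_Fsigma (z : Zfin) : separable_space A ->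
  Fsigma [set K | kappa_K0 K z].
Proof.
move=> A_sep.
have FT t : Fsigma [set K | relator_holds (class_valid K) (code_class K) t].
  case: t => [[[i j] k]|i].
    rewrite (_ : [set K | _] = code_sum_rel d (code i) (code j) (code k)).
      by apply: upper_open_Fsigma => // K; exact: code_sum_near.
    by apply/seteqP; split=> K /code_sum_relP.
  by apply: (@upper_closed_Fsigma _ _ (code_valid d (code i))); exact: code_valid_near.
pose C (s : seq (int * (nat * nat * nat + nat))) : set (closed_ideal A) :=
  [set K | forall ct, ct \in s -> relator_holds (class_valid K) (code_class K) ct.2].
rewrite (_ : [set K | _] =
    \bigcup_s (if gen_comb relator s == z then C s else set0)).
  apply: Fsigma_bigcup => s; case: ifP => _; last exact: Fsigma_set0.
  exact: (@Fsigma_seq_all _ _ s (fun ct =>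
    [set K | relator_holds (class_valid K) (code_class K) ct.2])).
apply/seteqP; split=> [K /asboolP[s [sP sz]]|K [s _]].
  by exists s => //; rewrite sz eqxx.
by case: eqP => // sz Cs; apply/asboolP; exists s.
Qed.
End CodeClasses.

Theorem theorem8p7 (R : realType) (A : cstarAlg R)
    (A_separable : separable_space A) (A_generator : quotient_generator A) :
  exists kappa : closed_ideal A -> subgroup Zfin,
    [/\ borel_map kappa,
        forall K : closed_ideal A,
          group_isomorphic (quotient_group (kappa K)) (K0 (quotient_algebra K)) &
        forall z : Zfin, Fsigma [set K : closed_ideal A | kappa K z]].
Proof.
have [d d_dense] := separable_dense_seq A_separable.
exists (kappa_K0 d); split=> [|K|z].
(* Finite lists of coefficients and indices enumerate [Zfin], which supplies the countability. *)
- apply: (@borel_map_subgroup _ _ _ (fun s : seq (int * nat) => [freeg s])).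
    by move=> z; exists (fgenum z); exact: Freeg_enum.
  by move=> z; apply: borel_Fsigma; exact: kappa_K0_Fsigma.
- apply: presentation_iso; first exact: code_class_surj.
  exact: code_class_invalid.
- exact: kappa_K0_Fsigma.
Qed.
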